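(* Let $w=y_1\cdots y_N$ be a nonempty freely and cyclically reduced word over $\Sigma_r$. Let $I=\{j: x_j^{\pm1}\text{ occurs in }w\}$, $s=|I|$, $X_I=\{x_j:j\in I\}$, $F_I=F(X_I)\le F_r$, and let $a_0=1$, $a_t=y_1\cdots y_t$ for $1\le t\le N$. Then the following are equivalent. (a) The element represented by $w$ is primitive in $F_r$. (b) There exist $s-1$ pairs of integers $(p_1,q_1),\dots,(p_{s-1},q_{s-1})$ with $0\le p_i<q_i<N$ such that $$F_I=\left\langle w,\ a_{p_1}a_{q_1}^{-1},\dots,a_{p_{s-1}}a_{q_{s-1}}^{-1}\right\rangle.$$ When these conditions hold, the pairs may be chosen so that sequentially identifying the images of $v_{p_i}$ and $v_{q_i}$ (for $i=1,\dots,s-1$, each identification followed by all forced Stallings folds) produces a chain of exactly $s-1$ immediate quotients from $S_w$ to the rose $R_{X_I}$.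
   Context: $r\ge 2$, $X_r=\{x_1,\dots,x_r\}$, $\Sigma_r=X_r\sqcup X_r^{-1}$, $F_r=F(X_r)$. An element is primitive in $F_r$ if it belongs to a free basis. A freely reduced word is cyclically reduced if it is empty or its first and last letters are not mutually inverse. $X$-graphs. For a finite basis $X$ and $\Sigma_X=X\sqcup X^{-1}$, a finite $X$-graph has finite sets of vertices and oriented edges, a fixed-point-free edge involution $e\mapsto\bar e$, initial and terminal maps $o,t$, and labels $\mu(e)\in\Sigma_X$ with $o(\bar e)=t(e)$, $t(\bar e)=o(e)$, $\mu(\bar e)=\mu(e)^{-1}$. An edge is outgoing at $v$ if $o(e)=v$. The graph is folded if at each vertex there is at most one outgoing edge with each label. A Stallings fold identifies two distinct edges outgoing at the same vertex with the same label, together with their terminal vertices and inverse edges; repeated folding terminates in a folded quotient, unique up to label-preserving isomorphism. An edge path $e_1\cdots e_n$ is reduced if $e_{i+1}\ne\bar e_i$ for all $i$. The pointed core of a connected pointed $X$-graph $(\Gamma,* )$ is the union of $*$ and all edges traversed by reduced closed paths based at $*$; a finite connected pointed folded $X$-graph equal to its pointed core is a pointed core graph. The rose $R_X$ has one vertex and one geometric loop for each $x\in X$. An immediate quotient of a finite pointed core graph $\Gamma$ is obtained by choosing two distinct vertices of $\Gamma$, identifying them, performing all forced Stallings folds, and passing to the resulting pointed core. The graph $S_w$ is the directed cycle spelling $w$, viewed as an $X_I$-graph: its vertices are $v_0,\dots,v_{N-1}$ with basepoint $v_0$, and the directed edge from $v_{t-1}$ to $v_t$ has label $y_t$ ($1\le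 t\le N$), indices modulo $N$. It is the pointed core graph of $\langle w\rangle$ over $X_I$. *)

(* Defs.v *)
From HB Require Import structures.
From mathcomp Require Import all_boot.

Set Implicit Arguments.
Unset Strict Implicit.
Unset Printing Implicit Defensive.

Local Open Scope group_scope.

(* The letters x and x^-1 over an alphabet T are (x, true) and (x, false). *)
Notation letter T := (T * bool)%type.

Definition linv (T : Type) (l : letter T) : letter T := (l.1, ~~ l.2).

Section Words.
Variable T : choiceType.
Implicit Types (l : letter T) (w s : seq (letter T)).

Definition freely_reduced w : bool := sorted (fun l l' => l' != linv l) w.

Definition cyclically_reduced w : bool :=
  if w is l :: w' then last l w' != linv l else true.

Definition reduce_cons l w : seq (letter T) :=
  if w is l' :: w' then (if l' == linv l then w' else l :: w) else [:: l].

Definition reduce w : seq (letter T) := foldr reduce_cons [::] w.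

Definition winv w : seq (letter T) := rev (map (@linv T) w).

Lemma linvK : involutive (@linv T).
Proof. by case=> x b; rewrite /linv /= negbK. Qed.

Lemma reduce_cons_reduced l w :
  freely_reduced w -> freely_reduced (reduce_cons l w).
Proof.
case: w => [|l' w] //= red_w; case: ifP => [_|/negbT neq]; first exact: path_sorted red_w.
by rewrite /= neq.
Qed.

Lemma foldr_reduced w s :
  freely_reduced s -> freely_reduced (foldr reduce_cons s w).
Proof. by move=> red_s; elim: w => //= l w; apply: reduce_cons_reduced. Qed.

Lemma reduce_reduced w : freely_reduced (reduce w).
Proof. exact: foldr_reduced. Qed.

Lemma reduce_id w : freely_reduced w -> reduce w = w.
Proof.
elim: w => //= l w IHw red_w; rewrite IHw; last exact: path_sorted red_w.
by case: w red_w {IHw} => [|l' w] //= /andP[/negPf-> _].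
Qed.

Lemma reduce_consK l s : freely_reduced s ->
  reduce_cons l (reduce_cons (linv l) s) = s.
Proof.
case: s => [|l' s] /=; first by rewrite eqxx.
rewrite linvK; case: (eqVneq l' l) => [->|_]; last by rewrite /= eqxx.
by case: s => //= l2 s /andP[/negPf-> _].
Qed.

Lemma foldr_reduce w s : freely_reduced s ->
  foldr reduce_cons s (reduce w) = foldr reduce_cons s w.
Proof.
move=> red_s; elim: w => //= l w <-.
case: (reduce w) => [|l' u] //=; case: eqP => [->|//].
by rewrite reduce_consK // foldr_reduced.
Qed.

Lemma reduce_catr u v : reduce (u ++ reduce v) = reduce (u ++ v).
Proof. by rewrite /reduce !foldr_cat [foldr _ _ (foldr _ _ v)]reduce_id ?reduce_reduced. Qed.

Lemma reduce_catl u v : reduce (reduce u ++ v) = reduce (u ++ v).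
Proof. by rewrite /reduce !foldr_cat foldr_reduce ?reduce_reduced. Qed.

Lemma reduce_winvr w : reduce (w ++ winv w) = [::].
Proof.
elim: w => //= l w IHw; rewrite /winv /= rev_cons -cats1 catA -/(winv w).
by rewrite -reduce_catl IHw /= eqxx.
Qed.

Lemma winvK : involutive winv.
Proof. by move=> w; rewrite /winv map_rev revK mapK //; apply: linvK. Qed.

Lemma reduce_winvl w : reduce (winv w ++ w) = [::].
Proof. by rewrite -{2}[w]winvK reduce_winvr. Qed.

Lemma winv_reduced w : freely_reduced w -> freely_reduced (winv w).
Proof.
rewrite /freely_reduced /winv rev_sorted sorted_map; apply: sub_sorted.
by move=> l l' /=; apply: contra => /eqP/(can_inj linvK)->; rewrite linvK.
Qed.

End Words.

(* The free group F(T), realised on freely reduced words. *)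
Record freegroup (T : choiceType) : Type := FreeGroup {
  fgword :> seq (letter T);
  fgwordP : freely_reduced fgword
}.

HB.instance Definition _ (T : choiceType) := [isSub for @fgword T].
HB.instance Definition _ (T : choiceType) := [Choice of freegroup T by <:].

Section FreeGroup.
Variable T : choiceType.
Implicit Types g h : freegroup T.

Definition fgelt (w : seq (letter T)) : freegroup T :=
  FreeGroup (reduce_reduced w).

Definition fg_mul g h : freegroup T := fgelt (fgword g ++ fgword h).
Definition fg_inv g : freegroup T := fgelt (winv g).

Fact fg_mulA : associative fg_mul.
Proof. by move=> g h k; apply: val_inj; rewrite /= reduce_catr reduce_catl catA. Qed.

Fact fg_mul1 : left_id (fgelt [::]) fg_mul.
Proof. by move=> g; apply: val_inj; rewrite /= reduce_id ?fgwordP. Qed.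

Fact fg_mulr1 : right_id (fgelt [::]) fg_mul.
Proof. by move=> g; apply: val_inj; rewrite /= cats0 reduce_id ?fgwordP. Qed.

Fact fg_mulV : left_inverse (fgelt [::]) fg_inv fg_mul.
Proof. by move=> g; apply: val_inj; rewrite /= reduce_catl reduce_winvl. Qed.

Fact fg_mulrV : right_inverse (fgelt [::]) fg_inv fg_mul.
Proof. by move=> g; apply: val_inj; rewrite /= reduce_catr reduce_winvr. Qed.

HB.instance Definition _ :=
  isGroup.Build (freegroup T) fg_mulA fg_mul1 fg_mulr1 fg_mulV fg_mulrV.

End FreeGroup.

Inductive generated (G : groupType) (S : seq G) : G -> Prop :=
| gen_in g : g \in S -> generated S g
| gen1 : generated S 1
| genM g h : generated S g -> generated S h -> generated S (g * h)
| genV g : generated S g -> generated S g^-1.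

Definition letter_val (G : groupType) (l : letter G) : G :=
  if l.2 then l.1 else l.1^-1.

(* B is a free basis of G: the canonical homomorphism F(B) -> G is bijective,
   F(B) consisting of the freely reduced words with all letters in B and
   their inverses. *)
Definition free_basis (G : groupType) (B : G -> Prop) : Prop :=
  forall g : G, exists! u : seq (letter G),
    [/\ freely_reduced u, forall l, l \in u -> B l.1
      & \prod_(l <- u) letter_val l = g].

Definition primitive (G : groupType) (g : G) : Prop :=
  exists2 B : G -> Prop, free_basis B & B g.

(* F(X) as a subgroup of F(T), for a subset X of the alphabet T. *)
Definition free_subgroup (T : finType) (X : {set T}) (g : freegroup T) : Prop :=
  forall l, l \in fgword g -> l.1 \in X.

(* Finite pointed X-graphs, X being a subset of an ambient alphabet T. *)
Record xgraph (T : finType) (X : {set T}) : Type := XGraph {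
  vertex : finType;
  edge : finType;
  base : vertex;
  org : edge -> vertex;
  ter : edge -> vertex;
  bar : edge -> edge;
  lab : edge -> letter T;
  barK : involutive bar;
  bar_neq : forall e, bar e != e;
  org_bar : forall e, org (bar e) = ter e;
  ter_bar : forall e, ter (bar e) = org e;
  lab_bar : forall e, lab (bar e) = linv (lab e);
  lab_in : forall e, (lab e).1 \in X
}.

Section XGraphs.
Variables (T : finType) (X : {set T}).
Implicit Types G H K : xgraph X.

Fixpoint walk G (x : vertex G) (p : seq (edge G)) (y : vertex G) : bool :=
  if p is e :: p' then (org e == x) && walk (ter e) p' y else x == y.

Definition reduced_path G (p : seq (edge G)) : bool :=
  sorted (fun e e' => e' != bar e) p.

Definition connected G : Prop :=
  forall v : vertex G, exists p, walk (base G) p v.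

Definition folded G : Prop :=
  forall e e' : edge G, org e = org e' -> lab e = lab e' -> e = e'.

Definition core_edge G (e : edge G) : Prop :=
  exists p, [/\ walk (base G) p (base G), reduced_path p & e \in p].

Definition core_vertex G (v : vertex G) : Prop :=
  v = base G \/ exists2 e : edge G, core_edge e & v = org e \/ v = ter e.

Definition pointed_core_graph G : Prop :=
  [/\ connected G, folded G, forall v : vertex G, core_vertex v
    & forall e : edge G, core_edge e].

Record xmorph G H : Type := XMorph {
  vmap :> vertex G -> vertex H;
  emap : edge G -> edge H;
  vmap_base : vmap (base G) = base H;
  vmap_org : forall e, vmap (org e) = org (emap e);
  emap_bar : forall e, emap (bar e) = bar (emap e);
  emap_lab : forall e, lab (emap e) = lab e
}.

Definition xmorph_id G : xmorph G G :=
  @XMorph G G id id (erefl _) (fun=> erefl _) (fun=> erefl _) (fun=> erefl _).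

Program Definition xmorph_comp G H K (g : xmorph H K) (f : xmorph G H) :
    xmorph G K :=
  @XMorph G K (g \o f) (emap g \o emap f) _ _ _ _.
Next Obligation. by move=> G H K g f /=; rewrite !vmap_base. Qed.
Next Obligation. by move=> G H K g f e /=; rewrite !vmap_org. Qed.
Next Obligation. by move=> G H K g f e /=; rewrite !emap_bar. Qed.
Next Obligation. by move=> G H K g f e /=; rewrite !emap_lab. Qed.

Definition xiso G H : Prop :=
  exists f : xmorph G H, bijective f /\ bijective (emap f).

Definition surjective (A B : Type) (f : A -> B) : Prop :=
  forall b, exists a, f a = b.

(* The equivalence relation generated by the single pair (u, v). *)
Definition merged (A : eqType) (u v x y : A) : bool :=
  [|| x == y, (x == u) && (y == v) | (x == v) && (y == u)].

(* Quotient graphs are described up to isomorphism by their quotient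
   morphism: a surjection whose kernel is the prescribed equivalence. *)
Definition identification G H (u v : vertex G) (f : xmorph G H) : Prop :=
  [/\ surjective f, forall x y, f x = f y <-> merged u v x y
    & bijective (emap f)].

(* The two merged pairs of edges are disjoint, since e1 and e2 have the same
   label and bar inverts labels; so the edge relation is an equivalence. *)
Definition stallings_fold G H (e1 e2 : edge G) (f : xmorph G H) : Prop :=
  [/\ e1 != e2, org e1 = org e2 & lab e1 = lab e2] /\
  [/\ surjective f, surjective (emap f),
      forall x y, f x = f y <-> merged (ter e1) (ter e2) x y
    & forall e e', emap f e = emap f e' <->
        merged e1 e2 e e' || merged (bar e1) (bar e2) e e'].

Inductive folds_to : forall G H, xmorph G H -> Prop :=
| folds_done G : folded G -> folds_to (xmorph_id G)
| folds_step G H K (e1 e2 : edge G) (f : xmorph G H) (g : xmorph H K) :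
    stallings_fold e1 e2 f -> folds_to g -> folds_to (xmorph_comp g f).

Inductive identify_and_fold G (u v : vertex G) :
    forall H, xmorph G H -> Prop :=
| IdentifyAndFold H K (f : xmorph G H) (g : xmorph H K) :
    identification u v f -> folds_to g ->
    identify_and_fold u v (xmorph_comp g f).

(* i embeds H as the pointed core of G. *)
Definition core_embedding H G (i : xmorph H G) : Prop :=
  [/\ injective i, injective (emap i),
      forall v, core_vertex v <-> exists x, i x = v
    & forall e, core_edge e <-> exists x, emap i x = e].

Definition immediate_quotient_at G (u v : vertex G) H : Prop :=
  [/\ pointed_core_graph G, u != v
    & exists K (f : xmorph G K) (i : xmorph H K),
        identify_and_fold u v f /\ core_embedding i].

(* quotient_chain phi ps K: starting from G with a marking phi of its
   vertices, identify successively, for the pairs (p, q) of ps, the current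
   images of p and q, folding each time; every step is an immediate quotient
   and the last graph is K. *)
Inductive quotient_chain (V : Type) :
    forall G, (V -> vertex G) -> seq (V * V) -> xgraph X -> Prop :=
| chain_nil G (phi : V -> vertex G) : quotient_chain phi [::] G
| chain_cons G H K (phi : V -> vertex G) (f : xmorph G H) p q ps :
    identify_and_fold (phi p) (phi q) f ->
    immediate_quotient_at (phi p) (phi q) H ->
    quotient_chain (f \o phi) ps K ->
    quotient_chain phi ((p, q) :: ps) K.

End XGraphs.

Section Rose.
Variables (T : finType) (X : {set T}).

Let rose_edge : finType := ({x : T | x \in X} * bool)%type.

Program Definition rose : xgraph X :=
  @XGraph T X unit rose_edge tt (fun=> tt) (fun=> tt)
    (fun e => (e.1, ~~ e.2)) (fun e => (val e.1, e.2)) _ _ _ _ _ _.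
Next Obligation. by case=> x b; rewrite /= negbK. Qed.
Next Obligation. by case=> x b; rewrite xpair_eqE; case: b; rewrite andbF. Qed.
Next Obligation. by []. Qed.
Next Obligation. by []. Qed.
Next Obligation. by []. Qed.
Next Obligation. by case=> x b; apply: (valP x). Qed.

End Rose.

Definition occurring (T : finType) (w : seq (letter T)) : {set T} :=
  [set x in unzip1 w].

Section CycleGraph.
Variables (T : finType) (w : seq (letter T)) (w_gt0 : (0 < size w)%N).
Let N := size w.

(* (t, true) is the edge from v_t to v_(t+1 mod N) labelled by the letter of
   index t of w (counting from 0), and (t, false) is its inverse. *)
Let cyc_edge : finType := ('I_N * bool)%type.
Let cyc_org (e : cyc_edge) : 'I_N := if e.2 then e.1 else ordS e.1.
Let cyc_ter (e : cyc_edge) : 'I_N := if e.2 then ordS e.1 else e.1.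
Let cyc_lab (e : cyc_edge) : letter T :=
  let l := tnth (in_tuple w) e.1 in if e.2 then l else linv l.

Program Definition cycle_graph : xgraph (occurring w) :=
  @XGraph T (occurring w) 'I_N cyc_edge (Ordinal w_gt0) cyc_org cyc_ter
    (fun e => (e.1, ~~ e.2)) cyc_lab _ _ _ _ _ _.
Next Obligation. by case=> t b; rewrite /= negbK. Qed.
Next Obligation. by case=> t b; rewrite xpair_eqE; case: b; rewrite andbF. Qed.
Next Obligation. by case=> t []. Qed.
Next Obligation. by case=> t []. Qed.
Next Obligation. by case=> t []; rewrite /cyc_lab //= linvK. Qed.
Next Obligation.
case=> t b; rewrite inE (_ : (cyc_lab _).1 = (tnth (in_tuple w) t).1).
  by apply: map_f; apply: mem_tnth.
by case: b.
Qed.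

End CycleGraph.

(* a_t, the element represented by the first t letters of w. *)
Definition prefix_elt (T : choiceType) (w : seq (letter T)) (t : nat) :
    freegroup T := fgelt (take t w).

(* The pairs ps satisfy p < q and, with w, generate F(X_I). *)
Definition generating_pairs (T : finType) (w : seq (letter T))
    (ps : seq ('I_(size w) * 'I_(size w))) : Prop :=
  all (fun pq : 'I_(size w) * 'I_(size w) => (pq.1 < pq.2)%N) ps /\
  forall g : freegroup T, free_subgroup (occurring w) g <->
    generated
      (fgelt w ::
        [seq prefix_elt w pq.1 * (prefix_elt w pq.2)^-1
          | pq : 'I_(size w) * 'I_(size w) <- ps]) g.

(* Main.v *)
(* [(a) => (b)]  Finitely many elements of a basis through [w], at most [r] of
   them, generate [F_r].  The wedge of the loops they spell, the one of [w] being
   [S_w], folds onto the rose of [F_r]; as the rank of the wedge is already at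
   most [r], no fold lowers the rank, so each one merges two distinct vertices.
   On the image of [S_w] such a fold is either a fold within the image, which
   keeps its rank, or the identification of two of its vertices, which raises it
   by one, or an isomorphism.  As this image ends up being the rose on [X_I], there
   are exactly [s - 1] identifications.  They are performed by choosing vertices
   of [S_w], and a merged pair [v_p, v_q] gives [a_p a_q^-1] in the subgroup [H]
   generated by [w] and the chosen pairs, because [v_t |-> H a_t] is compatible
   with folding.

   [(b) => (a)]  Add the letters outside [X_I] and apply the Hopf property.

   [(b) => chain]  Every element of [F_I] can be read as a loop in the folded graph
   obtained from the pairs, which is therefore the rose; its rank being [s], each
   of the [s - 1] identifications must have merged distinct vertices. *)

From mathcomp Require Import all_boot all_fingroup.
From mathcomp Require Import zify.
Require Import Defs.

Set Implicit Arguments.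
Unset Strict Implicit.
Unset Printing Implicit Defensive.

Local Open Scope group_scope.

(** * Words evaluated in a group *)

Section Evaluation.
Variables (T : choiceType) (G : groupType).
Implicit Types (f : T -> G) (u v : seq (letter T)).

Definition wprod f u : G := \prod_(l <- u) letter_val (f l.1, l.2).

Lemma wprod_nil f : wprod f [::] = 1.
Proof. by rewrite /wprod big_nil. Qed.

Lemma wprod_cons f l u : wprod f (l :: u) = letter_val (f l.1, l.2) * wprod f u.
Proof. by rewrite /wprod big_cons. Qed.

Lemma wprod_cat f u v : wprod f (u ++ v) = wprod f u * wprod f v.
Proof. by rewrite /wprod big_cat. Qed.

Lemma letter_val_linv (l : letter G) : letter_val (linv l) = (letter_val l)^-1.
Proof. by case: l => g []; rewrite /letter_val //= invgK. Qed.

Lemma wprod_reduce f u : wprod f (reduce u) = wprod f u.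
Proof.
elim: u => //= l u IHu; rewrite wprod_cons -{}IHu.
case: (reduce u) => [|l' v] /=; first by rewrite wprod_cons.
case: eqP => [->|_]; last by rewrite wprod_cons.
by rewrite wprod_cons (letter_val_linv (f l.1, l.2)) mulKVg.
Qed.

Lemma wprod_winv f u : wprod f (winv u) = (wprod f u)^-1.
Proof.
elim: u => [|l u IHu]; first by rewrite wprod_nil invg1.
rewrite /winv /= rev_cons -cats1 -/(winv u) wprod_cat IHu !wprod_cons wprod_nil.
by rewrite mulg1 invgM (letter_val_linv (f l.1, l.2)).
Qed.

Lemma eq_wprod f1 f2 u : f1 =1 f2 -> wprod f1 u = wprod f2 u.
Proof. by move=> eqf; apply: eq_bigr => l _; rewrite eqf. Qed.

Lemma generated_wprod f (S : seq G) :
  (forall g, generated S g) -> (forall g, g \in S -> exists t, f t = g) ->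
  forall g, exists2 u, freely_reduced u & wprod f u = g.
Proof.
move=> genS sSf g; suff [u <-]: exists u, wprod f u = g.
  by exists (reduce u); rewrite ?reduce_reduced ?wprod_reduce.
elim: {genS}(genS g) => {g} [g /sSf[t <-]||g h _ [u <-] _ [v <-]|g _ [u <-]].
- by exists [:: (t, true)]; rewrite wprod_cons wprod_nil mulg1.
- by exists [::]; rewrite wprod_nil.
- by exists (u ++ v); rewrite wprod_cat.
- by exists (winv u); rewrite wprod_winv.
Qed.

Lemma generated_wprod_in f (S : seq G) u :
  (forall l, l \in u -> generated S (f l.1)) -> generated S (wprod f u).
Proof.
elim: u => [|l u IHu] Sf; first by rewrite wprod_nil; apply: gen1.
rewrite wprod_cons; apply: genM; last first.
  by apply: IHu => l' ul'; apply: Sf; rewrite inE ul' orbT.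
have Sl := Sf l (mem_head _ _).
by rewrite /letter_val /=; case: l.2 => //; apply: genV.
Qed.

End Evaluation.

Definition fgvar (T : choiceType) (x : T) : freegroup T := fgelt [:: (x, true)].

Section FreeGroupEvaluation.
Variable T : choiceType.

Lemma fgeltM (u v : seq (letter T)) : fgelt (u ++ v) = fgelt u * fgelt v.
Proof. by apply: val_inj; rewrite /= reduce_catl reduce_catr. Qed.

Lemma fgeltV (u : seq (letter T)) : fgelt (winv u) = (fgelt u)^-1.
Proof.
apply: (mulgI (fgelt u)); rewrite mulgV -fgeltM.
by apply: val_inj; rewrite /= reduce_winvr.
Qed.

Lemma fgelt_id (g : freegroup T) : fgelt g = g.
Proof. by apply: val_inj; rewrite /= reduce_id // fgwordP. Qed.

Lemma fgelt1 (l : letter T) : fgelt [:: l] = letter_val (fgvar l.1, l.2).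
Proof. by case: l => x [] //; rewrite /letter_val /= -fgeltV. Qed.

Lemma wprod_fgvar (u : seq (letter T)) : wprod (@fgvar T) u = fgelt u.
Proof.
elim: u => [|l u IHu]; first by rewrite wprod_nil.
by rewrite wprod_cons IHu -cat1s fgeltM fgelt1.
Qed.

Lemma wprodM (G : groupType) (f : T -> G) (g h : freegroup T) :
  wprod f (g * h) = wprod f g * wprod f h.
Proof. by rewrite wprod_reduce wprod_cat. Qed.

Lemma wprodV (G : groupType) (f : T -> G) (g : freegroup T) :
  wprod f (g^-1) = (wprod f g)^-1.
Proof. by rewrite wprod_reduce wprod_winv. Qed.

Lemma wprod_comp (S : choiceType) (G : groupType) (f : T -> G)
    (b : S -> freegroup T) u :
  wprod f (wprod b u) = wprod (fun s => wprod f (b s)) u.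
Proof.
elim: u => [|l u IHu]; first by rewrite !wprod_nil.
rewrite !wprod_cons wprodM IHu; congr (_ * _).
by rewrite /letter_val /=; case: l.2; rewrite ?wprodV.
Qed.

Lemma wprod_inj (G : groupType) (f : T -> G) :
  (forall u, freely_reduced u -> wprod f u = 1 -> u = [::]) ->
  forall u v, freely_reduced u -> freely_reduced v ->
  wprod f u = wprod f v -> u = v.
Proof.
move=> ker1 u v red_u red_v eq_uv.
have /ker1 : freely_reduced (fgword ((fgelt u)^-1 * fgelt v)) by apply: fgwordP.
rewrite wprodM wprodV !wprod_reduce eq_uv mulVg => /(_ erefl) uv1.
have /(canRL (mulKVg _)) : (fgelt u)^-1 * fgelt v = 1 by apply: val_inj.
by rewrite mulg1 => /(congr1 val); rewrite /= !reduce_id.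
Qed.

End FreeGroupEvaluation.

(** * Residual finiteness, the Hopf property and free bases *)

Section ResiduallyFinite.
Variable T : finType.

(** Induction on [D]: following the permutation built so far by the transposition of [s x] and [f x]
    corrects the value at [x]. Values already prescribed differ from both points by injectivity, so
    they are kept. *)
Lemma extend_perm (A : finType) (D : seq A) (f : A -> A) :
  {in D &, injective f} -> exists s : {perm A}, {in D, s =1 f}.
Proof.
elim: D => [|x D IHD] injf; first by exists 1.
have [|s sf] := IHD.
  by move=> y z Dy Dz; apply: injf; rewrite inE ?Dy ?Dz orbT.
case: (boolP (x \in D)) => Dx.
  by exists s => y; rewrite inE => /orP[/eqP->|]; apply: sf.
exists (s * tperm (s x) (f x)) => y; rewrite inE permM.
case: eqVneq => [-> _|neq_yx /= Dy]; first by rewrite tpermL.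
rewrite tpermD ?(inj_eq perm_inj) 1?eq_sym // sf // 1?eq_sym //.
by apply: contra neq_yx => /eqP/injf-> //; rewrite inE ?eqxx ?Dy ?orbT.
Qed.

(** The positions [0] to [n] along [u] form a path on which each letter is a partial injection.
    Extending these injections to permutations gives an action in which [u] moves [0] to [n], hence
    acts nontrivially. *)
Lemma free_residually_finite (u : seq (letter T)) :
  freely_reduced u -> u != [::] ->
  exists n (f : T -> 'S_n), wprod f u <> 1.
Proof.
move=> red_u u_neq0; pose n := size u.
have u_neq (t : nat) l0 : (t.+1 < n)%N -> nth l0 u t.+1 != linv (nth l0 u t).
  by move=> lt_t; move/(sortedP l0): red_u => /(_ t lt_t).
have [l0 _]: exists l0, l0 \in u.
  by case: (u) u_neq0 => // l u' _; exists l; rewrite mem_head.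
(* [D x] collects the positions whose image under [x] the path prescribes: those just before a
   letter [x] and those just after an inverse of [x]. *)
pose D x : seq 'I_n.+1 := [seq i : 'I_n.+1 <- enum 'I_n.+1 |
  ((i < n)%N && (nth l0 u i == (x, true))) ||
  ((0 < i)%N && (nth l0 u i.-1 == (x, false)))].
have memD x i : (i \in D x) = ((i < n)%N && (nth l0 u i == (x, true))) ||
    ((0 < i)%N && (nth l0 u i.-1 == (x, false))).
  by rewrite mem_filter mem_enum andbT.
pose step x (i : 'I_n.+1) : 'I_n.+1 :=
  if (i < n)%N && (nth l0 u i == (x, true)) then inord i.+1 else inord i.-1.
have stepP x : {in D x &, injective (step x)}.
  move=> i j; rewrite !memD /step.
  have lti := ltn_ord i; have ltj := ltn_ord j.
  (* A forward and a backward move with the same target would come from consecutive, mutually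
     inverse letters. *)
  have nope (a b : nat) : (a < n)%N -> nth l0 u a = (x, true) -> (0 < b)%N ->
      (b <= n)%N -> nth l0 u b.-1 = (x, false) -> a.+1 <> b.-1.
    move=> lta ua gt0b leb ub eqab; have := u_neq a l0.
    by rewrite eqab ub ua /linv /= eqxx => /(_ _)/negP[]//; lia.
  case: (boolP (_ && _)) => [/andP[ltin /eqP ui] _|_ /= /andP[gt0i /eqP ui]];
  case: (boolP (_ && _)) => [/andP[ltjn /eqP uj] _|_ /= /andP[gt0j /eqP uj]];
  move/(congr1 val); rewrite /= !inordK; try lia; move=> eqij;
    try (apply: val_inj => /=; lia).
  - by case: (nope _ _ ltin ui gt0j _ uj eqij).
  - by case: (nope _ _ ltjn uj gt0i _ ui (esym eqij)).
have [f fP] : exists f : T -> {perm 'I_n.+1}, forall x, {in D x, f x =1 step x}.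
  apply: (fin_all_exists
    (P := fun x (s : {perm 'I_n.+1}) => {in D x, s =1 step x})).
  by move=> x; apply: extend_perm.
exists n.+1, f => fu1.
have move_to k : (k <= n)%N -> wprod f (take k u) ord0 = inord k.
  elim: k => [_|k IHk ltk].
    by rewrite take0 wprod_nil perm1; apply/val_inj; rewrite /= inordK.
  have ltkS : (k < n.+1)%N by apply: ltnW.
  rewrite (take_nth l0) // -cats1 wprod_cat permM IHk ?(ltnW ltk) //
    wprod_cons wprod_nil mulg1.
  case ul: (nth l0 u k) => [x []]; rewrite /letter_val /=.
    by rewrite fP ?memD /step inordK ?ltk ?ul ?eqxx.
  apply: (@perm_inj _ (f x)); rewrite permKV fP; last first.
    by rewrite memD inordK //= ul eqxx orbT.
  rewrite /step inordK //=; case: ifP => // /andP[ltk1 /eqP uk1].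
  by have := u_neq k l0 ltk1; rewrite ul uk1 /linv /= eqxx.
have := move_to n (leqnn n); rewrite take_size fu1 perm1 => /(congr1 val) /=.
by rewrite inordK // => /esym/eqP; rewrite size_eq0 (negPf u_neq0).
Qed.

End ResiduallyFinite.

Section Basis.
Variable T : finType.

(* A finite group [K] has finitely many homomorphisms [F(T) -> K], and
   precomposition with a surjective endomorphism, being injective, permutes them:
   every homomorphism to ['S_n] kills the kernel of [b]. *)
Lemma hopfian (b : T -> freegroup T) :
  (forall g, exists2 u, freely_reduced u & wprod b u = g) ->
  forall u, freely_reduced u -> wprod b u = 1 -> u = [::].
Proof.
move=> surj_b u red_u bu1; apply/eqP/negPn/negP => u_neq0.
have [n [f]] := free_residually_finite red_u u_neq0; apply.
pose pre (s : {ffun T -> 'S_n}) := [ffun t => wprod s (b t)].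
have inj_pre : injective pre.
  move=> s1 s2 eq_s; apply/ffunP => t; have [v _ bv] := surj_b (fgvar t).
  (* The word [v] spells the generator [t] through [b], so [pre s] determines [s t]. *)
  have wt (s : {ffun T -> 'S_n}) : s t = wprod (pre s) v.
    rewrite (eq_wprod (f2 := fun t => wprod s (b t))) => [|x]; last by rewrite ffunE.
    by rewrite -wprod_comp bv /= wprod_cons wprod_nil mulg1.
  by rewrite !wt eq_s.
have [inv _ preK] := injF_bij inj_pre; pose s := inv (finfun f).
have -> : wprod f u = wprod (pre s) u by apply: eq_wprod => t; rewrite preK ffunE.
rewrite (eq_wprod (f2 := fun t => wprod s (b t))) => [|x]; last by rewrite ffunE.
by rewrite -wprod_comp bu1 wprod_nil.
Qed.

(** The Hopf property makes [b] injective on reduced words, in particular on letters, so relabelling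
    by [b] matches reduced words over [T] with reduced words over its image. *)
Lemma free_basis_codom (b : T -> freegroup T) :
  (forall g, exists2 u, freely_reduced u & wprod b u = g) ->
  free_basis (fun g => exists t, b t = g).
Proof.
move=> surj_b; have inj_b := wprod_inj (hopfian surj_b).
have b_inj : injective b.
  move=> x y eq_xy; have := inj_b [:: (x, true)] [:: (y, true)].
  by rewrite !wprod_cons wprod_nil /= eq_xy => /(_ isT isT erefl)[].
pose bl (l : letter T) := (b l.1, l.2).
have red_bl u : freely_reduced (map bl u) = freely_reduced u.
  rewrite /freely_reduced sorted_map; apply: eq_sorted => -[x c] [y d] /=.
  by rewrite /linv /= !xpair_eqE (inj_eq b_inj).
have prod_bl u : \prod_(l <- map bl u) letter_val l = wprod b u.
  by rewrite big_map.
move=> g; have [u red_u bu] := surj_b g; exists (map bl u); split.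
  split; rewrite ?red_bl ?prod_bl // => l /mapP[l' _ ->]; by exists l'.1.
move=> v [red_v v_b]; have [v' v'v] : exists v', map bl v' = v.
  elim: v v_b {red_v} => [|[h c] v IHv] v_b; first by exists [::].
  have [|v' <-] := IHv; first by move=> l vl; apply: v_b; rewrite inE vl orbT.
  by have [/= t <-] := v_b _ (mem_head _ _); exists ((t, c) :: v').
rewrite -v'v prod_bl => bv'; congr map; apply: inj_b => //; last by rewrite bu.
by rewrite -red_bl v'v.
Qed.

Lemma generated_free_basis (S : seq (freegroup T)) :
  (size S <= #|T|)%N -> (forall g, generated S g) ->
  exists2 B, free_basis B & forall g, g \in S -> B g.
Proof.
(* The default value [1] pads [S] to a family indexed by [T] without affecting generation. *)
move=> leST genS; pose b (t : T) := nth 1 S (enum_rank t).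
have Sb g : g \in S -> exists t, b t = g.
  move=> Sg; have lt_i : (index g S < #|T|)%N by rewrite (leq_trans _ leST) ?index_mem.
  by exists (enum_val (Ordinal lt_i)); rewrite /b enum_valK nth_index.
exists (fun g => exists t, b t = g) => //.
by apply: free_basis_codom; apply: generated_wprod genS Sb.
Qed.

(* The [2 ^ size S] homomorphisms from the free group on [S] to ['S_2] restrict
   injectively to the images of the letters of [F(T)]. *)
Lemma free_basis_size (B : freegroup T -> Prop) (S : seq (freegroup T)) :
  free_basis B -> (forall g, g \in S -> B g) -> uniq S ->
  (forall g, generated S g) -> (size S <= #|T|)%N.
Proof.
move=> basB SB uS genS; pose b (i : 'I_(size S)) := tnth (in_tuple S) i.
have Sb g : g \in S -> exists i, b i = g.
  by move=> /(tnthP (in_tuple S))[i ->]; exists i.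
have surj_b := generated_wprod genS Sb.
have b_inj : injective b by apply/(tuple_uniqP (in_tuple S)).
pose bl (l : letter 'I_(size S)) := (b l.1, l.2).
have inj_b : forall u v, freely_reduced u -> freely_reduced v ->
    wprod b u = wprod b v -> u = v.
  move=> u v red_u red_v eq_uv.
  have [x [_ uniq_x]] := basB (wprod b u).
  have bl_inj : injective bl by move=> [i c] [j d] [/b_inj-> ->].
  apply: (inj_map bl_inj).
  have ok w : freely_reduced w -> wprod b w = wprod b u -> map bl w = x.
    move=> red_w eq_w; apply/esym/uniq_x; split.
    - rewrite /freely_reduced sorted_map; move: red_w.
      apply: sub_sorted => -[i c] [j d] /=.
      by rewrite /linv /= !xpair_eqE (inj_eq b_inj).
    - by move=> l /mapP[l' _ ->]; apply: SB; apply: mem_tnth.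
    - by rewrite big_map.
  by rewrite !ok.
have [v vP] : exists v : T -> seq (letter 'I_(size S)), forall t, wprod b (v t) = fgvar t.
  apply: (fin_all_exists (P := fun t u => wprod b u = fgvar t)) => t.
  by have [u _ bu] := surj_b (fgvar t); exists u.
pose pre (s : {ffun 'I_(size S) -> 'S_2}) := [ffun t => wprod s (v t)].
have inj_pre : injective pre.
  move=> s1 s2 eq_s; apply/ffunP => i.
  have si (s : {ffun 'I_(size S) -> 'S_2}) : s i = wprod (pre s) (b i).
    rewrite (eq_wprod (f2 := fun t => wprod s (fgelt (v t)))); last first.
      by move=> t; rewrite ffunE wprod_reduce.
    (* Substituting the words [v] for the generators in [b i] gives a reduced word over [S] with
       value [b i]; by freeness it is the single letter [i]. *)
    rewrite -wprod_comp; set g := wprod (fun t => fgelt (v t)) _.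
    have -> : fgword g = [:: (i, true)].
      apply: inj_b; rewrite ?fgwordP // /g wprod_comp.
      rewrite (eq_wprod (f2 := @fgvar T)) => [|t]; last by rewrite wprod_reduce.
      by rewrite wprod_fgvar fgelt_id wprod_cons wprod_nil mulg1.
    by rewrite wprod_cons wprod_nil mulg1.
  by rewrite !si eq_s.
have := leq_card pre inj_pre; rewrite !card_ffun card_ord card_Sn.
by rewrite leq_exp2l.
Qed.

(** Only finitely many elements of [B] occur in chosen words spelling the generators of [F(T)]; with
    [g0] they generate, and the rank bound counts them. Deleting [g0] from the list keeps [g0 :: S]
    duplicate-free, as that bound requires. *)
Lemma finite_free_basis (B : freegroup T -> Prop) (g0 : freegroup T) :
  free_basis B -> B g0 ->
  exists2 S : seq (freegroup T), (size S < #|T|)%N & forall g, generated (g0 :: S) g.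
Proof.
move=> basB Bg0.
have [v vP] : exists v : T -> seq (letter (freegroup T)), forall t,
    (forall l, l \in v t -> B l.1) /\ \prod_(l <- v t) letter_val l = fgvar t.
  apply: (fin_all_exists (P := fun t u => (forall l, l \in u -> B l.1) /\
    \prod_(l <- u) letter_val l = fgvar t)) => t.
  by have [u [[]]] := basB (fgvar t); exists u.
pose L := undup (flatten [seq unzip1 (v t) | t <- enum T]).
pose S := [seq g <- L | g != g0].
have genS g : generated (g0 :: S) g.
  rewrite -[g]fgelt_id -wprod_fgvar.
  apply: generated_wprod_in => -[t c] _ /=; have [_ <-] := vP t.
  rewrite (_ : \prod_(l <- v t) letter_val l = wprod id (v t)); last first.
    by apply: eq_bigr => -[].
  apply: generated_wprod_in => l vl; apply: gen_in; rewrite inE mem_filter.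
  case: eqP => //= _; rewrite mem_undup; apply/flatten_mapP; exists t.
    by rewrite mem_enum.
  exact: map_f.
exists S => //; rewrite -[(size S < _)%N]/(size (g0 :: S) <= _)%N.
apply: (free_basis_size basB) => //.
  move=> g; rewrite inE => /orP[/eqP-> //|]; rewrite mem_filter => /andP[_].
  rewrite mem_undup => /flatten_mapP[t _ /mapP[l vl ->]].
  by have [vB _] := vP t; apply: vB.
by rewrite /= mem_filter eqxx /= filter_uniq ?undup_uniq.
Qed.

End Basis.

(** * Folding and rank *)

Lemma card_imset_merged (A B : finType) (f : A -> B) (D : {set A}) u v :
  {in D &, forall x y, f x = f y <-> merged u v x y} ->
  (#|f @: D| + ((u != v) && (u \in D) && (v \in D)) = #|D|)%N.
Proof.
move=> fP; case: (boolP ((u != v) && (u \in D) && (v \in D)));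
  last first.
  move=> /negbTE uvD; rewrite addn0 card_in_imset // => x y Dx Dy.
  move=> /(fP _ _ Dx Dy)/or3P[/eqP//||] /andP[/eqP x_v /eqP y_v];
  move: uvD Dx Dy; rewrite x_v y_v;
  by case: (eqVneq u v) => //= _ + Du Dv; rewrite Du Dv.
move=> /andP[/andP[neq_uv Du] Dv].
have -> : f @: D = f @: (D :\ v).
  apply/setP => z; apply/imsetP/imsetP => -[x Dx ->]; last first.
    by exists x => //; case/setD1P: Dx.
  case: (eqVneq x v) => [->|neq_xv]; last by exists x; rewrite // !inE neq_xv.
  exists u; first by rewrite !inE neq_uv.
  by apply/(fP _ _ Dv Du); rewrite /merged !eqxx !orbT.
rewrite card_in_imset => [|x y /setD1P[xv Dx] /setD1P[yv Dy]].
  by rewrite (cardsD1 v D) Dv addnC.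
by move=> /(fP _ _ Dx Dy)/or3P[/eqP//||] /andP[]; rewrite ?(negPf xv) ?(negPf yv).
Qed.

Section Graphs.
Variables (T : finType) (X : {set T}).
Implicit Types G H K C : xgraph X.

(** Positively labelled edges represent the geometric edges. For a connected graph their number
    minus that of the vertices is the rank minus one; it is compared below in additive form. *)
Definition pos_edges G : {set edge G} := [set e | (lab e).2].

Definition pos_edge G (e : edge G) : edge G := if (lab e).2 then e else bar e.

Lemma bar_inj G : injective (@bar _ _ G).
Proof. exact: can_inj (@barK _ _ G). Qed.

Lemma pos_edgeP G (e : edge G) : pos_edge e \in pos_edges G.
Proof. by rewrite inE /pos_edge; case: ifP => // neg_e; rewrite lab_bar /= neg_e. Qed.

Lemma card_edges G : #|edge G| = (#|pos_edges G|).*2.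
Proof.
rewrite -[LHS](cardsC (pos_edges G)) -addnn; congr addn.
rewrite -[RHS](card_imset _ (@bar_inj G)); apply: eq_card => e; rewrite !inE.
apply/idP/imsetP => [neg_e|[e' + ->]]; last by rewrite inE lab_bar /= => ->.
by exists (bar e); rewrite ?barK // inE lab_bar.
Qed.

Section Morphisms.
Variables (C G : xgraph X) (phi : xmorph C G).

Definition vimage : {set vertex G} := phi @: [set: vertex C].
Definition eimage : {set edge G} := [set emap phi e | e in pos_edges C].

Lemma vmap_ter e : phi (ter e) = ter (emap phi e).
Proof. by rewrite -org_bar vmap_org emap_bar org_bar. Qed.

Lemma pos_edge_eimage e :
  reflect (exists d, emap phi d = e) (pos_edge e \in eimage).
Proof.
apply: (iffP imsetP) => [[d _]|[d <-]]; last first.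
  exists (pos_edge d); first exact: pos_edgeP.
  by rewrite /pos_edge emap_lab; case: ifP => // _; rewrite emap_bar.
rewrite /pos_edge; case: ifP => _ def_e; first by exists d.
by exists (bar d); rewrite emap_bar -def_e barK.
Qed.

Lemma eimage_pos : eimage \subset pos_edges G.
Proof. by apply/subsetP => _ /imsetP[e + ->]; rewrite !inE emap_lab. Qed.

End Morphisms.

Lemma vimage_comp C G H (phi : xmorph C G) (f : xmorph G H) :
  vimage (xmorph_comp f phi) = f @: vimage phi.
Proof. by rewrite /vimage -imset_comp. Qed.

Lemma eimage_comp C G H (phi : xmorph C G) (f : xmorph G H) :
  eimage (xmorph_comp f phi) = emap f @: eimage phi.
Proof. by rewrite /eimage -imset_comp. Qed.

Lemma vimage_surj G H (f : xmorph G H) : surjective f -> vimage f = setT.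
Proof.
by move=> surj_f; apply/setP => y; rewrite inE; have [x <-] := surj_f y; apply: imset_f.
Qed.

Lemma eimage_surj G H (f : xmorph G H) :
  surjective (emap f) -> eimage f = pos_edges H.
Proof.
move=> surj_f; apply/eqP; rewrite eqEsubset eimage_pos; apply/subsetP => e.
have [d def_e] := surj_f e; have : pos_edge e \in eimage f.
  by apply/pos_edge_eimage; exists d.
by rewrite inE /pos_edge; case: ifP.
Qed.

Section StallingsFold.
Variables (G H : xgraph X) (e1 e2 : edge G) (f : xmorph G H).
Hypothesis f_fold : stallings_fold e1 e2 f.

Lemma fold_vertices (A : {set vertex G}) :
  (#|f @: A| + ((ter e1 != ter e2) && (ter e1 \in A) && (ter e2 \in A)) = #|A|)%N.
Proof. by case: f_fold => _ [_ _ fP _]; apply: card_imset_merged => x y _ _. Qed.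

(** Equal labels orient [e1] and [e2] alike, so exactly one of the two merged pairs of edges is
    positive. *)
Lemma fold_edges (D : {set edge G}) : D \subset pos_edges G ->
  (#|emap f @: D| + ((pos_edge e1 \in D) && (pos_edge e2 \in D)) = #|D|)%N.
Proof.
case: f_fold => [[neq_e _ eq_lab] [_ _ _ fP]] /subsetP sD.
have neq_pos : pos_edge e1 != pos_edge e2.
  by rewrite /pos_edge eq_lab; case: ifP; rewrite ?(inj_eq (@bar_inj G)).
rewrite -[RHS](@card_imset_merged _ _ (emap f) D (pos_edge e1) (pos_edge e2)).
  by rewrite neq_pos.
move=> x y /sD + /sD; rewrite !inE => pos_x pos_y; rewrite fP.
have neq_lab (a b : edge G) : (lab a).2 -> (lab b).2 = false -> (a == b) = false.
  by move=> pa nb; apply/eqP => eq_ab; rewrite eq_ab nb in pa.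
rewrite /pos_edge eq_lab /merged; case: ifP => lab2.
  have lab1 : (lab e1).2 by rewrite eq_lab.
  have negE (z e : edge G) : (lab z).2 -> (lab e).2 -> (z == bar e) = false.
    by move=> pz pe; rewrite neq_lab // lab_bar /= pe.
  by rewrite !negE //=; case: (eqVneq x y) => //=; rewrite orbF.
have lab1 : (lab e1).2 = false by rewrite eq_lab.
by rewrite !(neq_lab x e1, neq_lab x e2) //=; case: (eqVneq x y).
Qed.

(** One geometric edge always disappears; a vertex disappears too unless the terminal vertices
    already agree, and only in that case does the rank drop. *)
Lemma fold_rank :
  (#|pos_edges H|.+1 = #|pos_edges G| /\ #|vertex H| + (ter e1 != ter e2) = #|vertex G|)%N.
Proof.
have [_ [surj_v surj_e _ _]] := f_fold; split.
  rewrite -(eimage_surj surj_e) -addn1 -(fold_edges (subxx _)).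
  by rewrite !pos_edgeP.
rewrite -!cardsT -(vimage_surj surj_v) -(fold_vertices setT) !inE !andbT.
by [].
Qed.

End StallingsFold.

Lemma folds_to_surjective G H (f : xmorph G H) :
  folds_to f -> surjective f /\ surjective (emap f).
Proof.
elim=> {G H f} [G _|G H K e1 e2 f g f_fold _ [surj_g surj_eg]].
  by split=> x; exists x.
have [_ [surj_f surj_ef _ _]] := f_fold; split=> z.
  by have [y <-] := surj_g z; have [x <-] := surj_f y; exists x.
by have [y <-] := surj_eg z; have [x <-] := surj_ef y; exists x.
Qed.

Lemma folds_to_folded G H (f : xmorph G H) : folds_to f -> folded H.
Proof. by elim. Qed.

Lemma folds_to_rank G H (f : xmorph G H) : folds_to f ->
  (#|pos_edges H| + #|vertex G| <= #|pos_edges G| + #|vertex H|)%N.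
Proof.
elim=> {G H f} [G _|G H K e1 e2 f g f_fold _ IH]; first by [].
by have [] := fold_rank f_fold; lia.
Qed.

(** The last clause is stability under forced folds. Quantifying over all such relations that
    contain given pairs replaces the construction of the relation which these pairs generate. *)
Definition congruence C (R : vertex C -> vertex C -> Prop) : Prop :=
  [/\ forall x, R x x, forall x y, R x y -> R y x,
      forall x y z, R x y -> R y z -> R x z
    & forall e e', R (org e) (org e') -> lab e = lab e' -> R (ter e) (ter e')].

(* A pair is recorded for each fold whose two terminal vertices lie in the image of
   [C] although one of the two folded edges does not. *)
Lemma folds_to_image_pairs C G K (phi : xmorph C G) (g : xmorph G K) :
  folds_to g ->
  (#|pos_edges G| + #|vertex K| <= #|pos_edges K| + #|vertex G|)%N ->
  exists ps : seq (vertex C * vertex C),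
  [/\ all (fun pq => pq.1 != pq.2) ps,
      (size ps + #|eimage phi| + #|vimage (xmorph_comp g phi)| =
       #|eimage (xmorph_comp g phi)| + #|vimage phi|)%N
    & forall R, congruence R -> (forall pq, pq \in ps -> R pq.1 pq.2) ->
      (forall x y, phi x = phi y -> R x y) ->
      forall x y, g (phi x) = g (phi y) -> R x y].
Proof.
move=> g_folds; elim: g_folds phi =>
  {G K g} [G _|G H K e1 e2 f g f_fold g_folds IH] phi rank_le.
  by exists [::]; split.
have [rank_e rank_v] := fold_rank f_fold; have rank_g := folds_to_rank g_folds.
(* A fold with equal terminal vertices would lose rank, which the hypothesis excludes since later
   folds cannot regain it. *)
have neq_ter : ter e1 != ter e2 by case: eqP rank_v => //; lia.
have [|ps [ps_neq ps_size ps_R]] := IH (xmorph_comp f phi).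
  by move: rank_v; rewrite neq_ter; lia.
have [[_ eq_org eq_lab] [_ _ fP _]] := f_fold.
have := fold_vertices f_fold (vimage phi); have := fold_edges f_fold (eimage_pos phi).
rewrite -vimage_comp -eimage_comp neq_ter /=.
have kerf R : congruence R -> (forall x y, phi x = phi y -> R x y) ->
    (forall x y, phi x = ter e1 -> phi y = ter e2 -> R x y) ->
    forall x y, f (phi x) = f (phi y) -> R x y.
  move=> [_ Rsym _ _] kerR R12 x y.
  move=> /fP/or3P[/eqP/kerR//||] /andP[/eqP px /eqP py].
    exact: R12.
  by apply: Rsym; apply: R12.
rewrite -[vimage (xmorph_comp (xmorph_comp g f) phi)]/
  (vimage (xmorph_comp g (xmorph_comp f phi))).
rewrite -[eimage (xmorph_comp (xmorph_comp g f) phi)]/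
  (eimage (xmorph_comp g (xmorph_comp f phi))).
case: (boolP (_ && _)) => [/andP[]|].
  (* Both edges come from [C]: the image loses an edge and a vertex, and [R] relates the terminal
     vertices by its stability under folds. *)
  move=> /pos_edge_eimage[d1 def_e1] /pos_edge_eimage[d2 def_e2].
  rewrite -def_e1 -def_e2 -!vmap_ter !imset_f //= => card_e card_v.
  exists ps; split=> //; first by lia.
  move=> R congR Rps kerR; apply: ps_R => //; apply: kerf => // x y.
  rewrite -def_e1 -def_e2 -!vmap_ter => /kerR Rx /esym/kerR Ry.
  case: congR => _ _ Rtrans Rfold.
  apply: (Rtrans _ _ _ Rx); apply: Rtrans Ry; apply: Rfold; last first.
    by rewrite -(emap_lab phi d1) -(emap_lab phi d2) def_e1 def_e2.
  by apply: kerR; rewrite !vmap_org def_e1 def_e2.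
(* Otherwise the image keeps all its edges. If both terminal vertices lie in it, it loses a vertex,
   and preimages of the two are recorded as a new pair. *)
move=> _ card_e; case: (boolP (_ && _)) =>
  [/andP[/imsetP[x1 _ def1] /imsetP[x2 _ def2]]|notV] card_v.
  exists ((x1, x2) :: ps); split=> /=.
  - rewrite ps_neq andbT; apply: contraNneq neq_ter => eq_x.
    by rewrite def1 def2 eq_x.
  - by lia.
  - move=> R congR Rps kerR; apply: ps_R => //.
      by move=> pq ps_pq; apply: Rps; rewrite inE ps_pq orbT.
    apply: kerf => // x y; rewrite def1 def2 => /kerR Rx /esym/kerR Ry.
    case: congR => _ _ Rtrans _; apply: (Rtrans _ _ _ Rx); apply: Rtrans Ry.
    by apply: (Rps (x1, x2)); rewrite mem_head.
(* Here the fold is injective on the image of [C], so nothing is recorded. *)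
exists ps; split=> //; first by lia.
move=> R congR Rps kerR; apply: ps_R => //; apply: kerf => // x y px py.
by rewrite -px -py !imset_f in notV.
Qed.

End Graphs.

(** * Existence of quotients *)

Section Quotients.
Variables (T : finType) (X : {set T}).
Implicit Types G H K C : xgraph X.

(* [c] and [d] choose representatives; the quotient consists of their fixed
   points. *)
Section QuotientGraph.
Variables (G : xgraph X) (c : vertex G -> vertex G) (d : edge G -> edge G).
Hypotheses (cK : forall x, c (c x) = c x) (dK : forall e, d (d e) = d e).
Hypotheses (d_bar : forall e, d (bar e) = bar (d e)).
Hypotheses (c_org : forall e, c (org (d e)) = c (org e)).
Hypotheses (d_lab : forall e, lab (d e) = lab e).

Let qvertex : finType := {x : vertex G | c x == x}.
Let qedge : finType := {e : edge G | d e == e}.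

Let qv (x : vertex G) : qvertex := exist _ (c x) (introT eqP (cK x)).
Let qe (e : edge G) : qedge := exist _ (d e) (introT eqP (dK e)).

Let qeK (e : qedge) : d (val e) = val e.
Proof. exact/eqP/(valP e). Qed.

Let qorg (e : qedge) : qvertex := qv (org (val e)).
Let qter (e : qedge) : qvertex := qv (ter (val e)).
Let qbar (e : qedge) : qedge := qe (bar (val e)).

Fact quotient_barK : involutive qbar.
Proof. by move=> e; apply: val_inj; rewrite /= !d_bar barK !qeK. Qed.

Fact quotient_bar_neq e : qbar e != e.
Proof. by rewrite -val_eqE /= d_bar qeK bar_neq. Qed.

Fact quotient_org_bar e : qorg (qbar e) = qter e.
Proof. by apply: val_inj; rewrite /= c_org org_bar. Qed.

Fact quotient_ter_bar e : qter (qbar e) = qorg e.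
Proof. by apply: val_inj; rewrite /= -org_bar -d_bar c_org barK. Qed.

Fact quotient_lab_bar e : lab (val (qbar e)) = linv (lab (val e)).
Proof. by rewrite /= d_lab lab_bar. Qed.

Definition quotient_graph : xgraph X :=
  @XGraph T X qvertex qedge (qv (base G)) qorg qter qbar (fun e => lab (val e))
    quotient_barK quotient_bar_neq quotient_org_bar quotient_ter_bar
    quotient_lab_bar (fun e => lab_in (val e)).

Fact quotient_vmap_org e : qv (org e) = qorg (qe e).
Proof. by apply: val_inj; rewrite /= c_org. Qed.

Fact quotient_emap_bar e : qe (bar e) = qbar (qe e).
Proof. by apply: val_inj; rewrite /= !d_bar dK. Qed.

Definition quotient_morphism : xmorph G quotient_graph :=
  @XMorph T X G quotient_graph qv qe erefl quotient_vmap_org quotient_emap_bar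
    d_lab.

Lemma quotient_morphism_surj :
  surjective quotient_morphism /\ surjective (emap quotient_morphism).
Proof.
split=> [x|e]; first by exists (val x); apply/val_inj/eqP/(valP x).
by exists (val e); apply: val_inj; apply: qeK.
Qed.

Lemma quotient_morphism_vker x y :
  quotient_morphism x = quotient_morphism y <-> c x = c y.
Proof. by split=> [/(congr1 val)//|eq_c]; apply: val_inj. Qed.

Lemma quotient_morphism_eker e e' :
  emap quotient_morphism e = emap quotient_morphism e' <-> d e = d e'.
Proof. by split=> [/(congr1 val)//|eq_d]; apply: val_inj. Qed.

End QuotientGraph.

Let collapse (A : eqType) (u v x : A) : A := if x == v then u else x.

Let collapseK (A : eqType) (u v x : A) :
  collapse u v (collapse u v x) = collapse u v x.
Proof. by rewrite /collapse; case: (eqVneq x v) => [_|/negbTE->//]; case: ifP. Qed.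

Let collapse_eq (A : eqType) (u v x y : A) :
  collapse u v x = collapse u v y <-> merged u v x y.
Proof.
rewrite /collapse /merged; case: (eqVneq x v) => [->|neq_xv];
  case: (eqVneq y v) => [->|neq_yv].
- by split.
- by rewrite !andbF /=; split=> [->|/eqP].
- by rewrite (negPf neq_xv) /= andbT orbF; split=> [->|/eqP].
- by rewrite andbF /= orbF; split=> /eqP.
Qed.

Lemma identification_exists G (u v : vertex G) :
  exists H (f : xmorph G H), identification u v f.
Proof.
have idK (e : edge G) : id (id e) = id e by [].
have [surj_v surj_e] := quotient_morphism_surj (collapseK u v) idK
  (fun=> erefl) (fun=> erefl) (fun=> erefl).
exists _, (quotient_morphism (collapseK u v) idK (fun=> erefl) (fun=> erefl)
  (fun=> erefl)).
split=> //; first by move=> x y; rewrite quotient_morphism_vker collapse_eq.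
exists val => e; first by [].
exact: val_inj.
Qed.

Lemma stallings_fold_exists G (e1 e2 : edge G) :
  e1 != e2 -> org e1 = org e2 -> lab e1 = lab e2 ->
  exists H (f : xmorph G H), stallings_fold e1 e2 f.
Proof.
move=> neq_e eq_org eq_lab.
(* Edges with the same label cannot be mutually inverse, so the collapses of [e2] to [e1] and of
   [bar e2] to [bar e1] do not interfere. *)
have neq_bar (e e' : edge G) : lab e = lab e' -> (e == bar e') = false.
  move=> eq_l; apply/eqP => def_e; move: eq_l; rewrite def_e lab_bar.
  by move=> /(congr1 snd) /=; case: (lab e').2.
pose c := collapse (ter e1) (ter e2).
pose d := collapse e1 e2 \o collapse (bar e1) (bar e2).
have dE e : d e = if e == e2 then e1 else if e == bar e2 then bar e1 else e.
  rewrite /d /= /collapse; case: (eqVneq e (bar e2)) => [->|neq].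
    by rewrite ![bar _ == _]eq_sym !neq_bar.
  by [].
have dK e : d (d e) = d e.
  rewrite [d e]dE; case: (eqVneq e e2) => [_|n2].
    by rewrite dE (negPf neq_e) neq_bar.
  case: (eqVneq e (bar e2)) => [_|nb2]; last by rewrite dE (negPf n2) (negPf nb2).
  by rewrite dE (inj_eq (@bar_inj _ _ G)) (negPf neq_e) eq_sym neq_bar.
have d_bar e : d (bar e) = bar (d e).
  have eq_bar : (e == bar e2) = (bar e == e2).
    by rewrite -(inj_eq (@bar_inj _ _ G)) barK.
  rewrite !dE eq_bar (inj_eq (@bar_inj _ _ G)).
  case: (eqVneq e e2) => [->|_]; first by rewrite eq_sym neq_bar.
  by case: ifP => // _; rewrite barK.
have c_org e : c (org (d e)) = c (org e).
  rewrite dE; case: (eqVneq e e2) => [->|_]; first by rewrite eq_org.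
  case: (eqVneq e (bar e2)) => [->|//]; rewrite !org_bar /c /collapse eqxx.
  by case: ifP.
have d_lab e : lab (d e) = lab e.
  rewrite dE; case: (eqVneq e e2) => [->//|_].
  by case: (eqVneq e (bar e2)) => [->|//]; rewrite !lab_bar eq_lab.
have cK x : c (c x) = c x by apply: collapseK.
have [surj_v surj_e] := quotient_morphism_surj cK dK d_bar c_org d_lab.
exists _, (quotient_morphism cK dK d_bar c_org d_lab); split=> //.
split=> //; first by move=> x y; rewrite quotient_morphism_vker collapse_eq.
move=> e e'; rewrite quotient_morphism_eker; split=> [|/orP[]].
- rewrite !dE /merged.
  have [->|n1] := eqVneq e e2; have [->|n2] := eqVneq e' e2; rewrite ?eqxx //=.
  + case: eqVneq => [->|nb2] /eqP; first by rewrite neq_bar.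
    by rewrite eq_sym => ->; rewrite orbT.
  + case: eqVneq => [->|nb2] /eqP; first by rewrite eq_sym neq_bar.
    by move=> ->; rewrite orbT.
  + have [->|m1] := eqVneq e (bar e2); have [->|m2] := eqVneq e' (bar e2);
    rewrite ?eqxx ?orbT //=.
    * by move=> ->; rewrite eqxx !orbT.
    * by move=> ->; rewrite eqxx !orbT.
    * by move=> ->; rewrite eqxx.
- rewrite !dE => /or3P[/eqP->//||] /andP[/eqP-> /eqP->];
  by rewrite eqxx (negPf neq_e) neq_bar.
- rewrite /merged => /or3P[/eqP->//||] /andP[/eqP-> /eqP->];
  by rewrite !d_bar !dE eqxx (negPf neq_e) neq_bar.
Qed.

(** Folding terminates because each fold loses a geometric edge. *)
Lemma folds_to_exists G : exists H (f : xmorph G H), folds_to f.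
Proof.
have [n] := ubnP #|pos_edges G|; elim: n G => // n IHn G ltGn.
pose bad (e e' : edge G) := [&& e != e', org e == org e' & lab e == lab e'].
case: (boolP [exists e, exists e', bad e e']).
  move=> /existsP[e1 /existsP[e2 /and3P[neq_e /eqP eq_org /eqP eq_lab]]].
  have [H [f f_fold]] := stallings_fold_exists neq_e eq_org eq_lab.
  have [rank_e _] := fold_rank f_fold.
  have [|K [g g_folds]] := IHn H; first by lia.
  by exists K, (xmorph_comp g f); apply: folds_step f_fold g_folds.
move=> /existsPn no_bad; exists G, (xmorph_id G).
apply: folds_done => e e' eq_org eq_lab.
have /existsPn/(_ e') := no_bad e.
by rewrite /bad eq_org eq_lab !eqxx !andbT negbK => /eqP.
Qed.

Lemma identify_and_fold_exists G (u v : vertex G) :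
  exists H (f : xmorph G H), identify_and_fold u v f.
Proof.
have [H [f f_id]] := identification_exists u v.
have [K [g g_folds]] := folds_to_exists H.
by exists K, (xmorph_comp g f); apply: IdentifyAndFold f_id g_folds.
Qed.

(** The identification keeps the edges and loses a vertex when [u != v]; the folds after it cannot
    raise the rank, so the gain is at most one. *)
Lemma identify_and_foldP G H (u v : vertex G) (f : xmorph G H) :
  identify_and_fold u v f ->
  [/\ surjective f /\ surjective (emap f), folded H, f u = f v
    & (#|pos_edges H| + #|vertex G| <= #|pos_edges G| + #|vertex H| + (u != v))%N].
Proof.
case=> {H f} H K f g [surj_f f_eq f_bij] g_folds.
have [surj_g surj_eg] := folds_to_surjective g_folds.
have surj_ef : surjective (emap f) by case: f_bij => h _ fK e; exists (h e).
split.
- split=> z.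
    by have [y <-] := surj_g z; have [x <-] := surj_f y; exists x.
  by have [y <-] := surj_eg z; have [x <-] := surj_ef y; exists x.
- exact: folds_to_folded g_folds.
- by congr (g _); apply/f_eq; rewrite /merged !eqxx orbT.
have := folds_to_rank g_folds.
have -> : #|pos_edges H| = #|pos_edges G|.
  by rewrite -(eimage_surj surj_ef) card_imset //; apply: bij_inj.
have := @card_imset_merged _ _ f setT u v (fun x y _ _ => f_eq x y).
rewrite -/(vimage f) vimage_surj // !inE !andbT !cardsT; lia.
Qed.

End Quotients.

(** * Words read in a graph *)

Section Reading.
Variables (T : finType) (X : {set T}).
Implicit Types G H K C : xgraph X.

Definition reads G (x : vertex G) (u : seq (letter T)) (y : vertex G) : Prop :=
  exists2 p, walk x p y & map (@lab _ _ G) p = u.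

Lemma walk_cat G (x y z : vertex G) p q :
  walk x p y -> walk y q z -> walk x (p ++ q) z.
Proof.
elim: p x => [|e p IHp] x /=; first by move/eqP->.
by case/andP=> -> /= wp wq; apply: IHp.
Qed.

Lemma walk_rev G (x y : vertex G) p :
  walk x p y -> walk y (rev (map (@bar _ _ G) p)) x.
Proof.
elim: p x => [|e p IHp] x /=; first by rewrite eq_sym.
case/andP=> /eqP <- wp; rewrite rev_cons -cats1.
by apply: walk_cat (IHp _ wp) _; rewrite /= org_bar ter_bar !eqxx.
Qed.

Lemma walk_map G H (f : xmorph G H) (x y : vertex G) p :
  walk x p y -> walk (f x) (map (emap f) p) (f y).
Proof.
elim: p x => [|e p IHp] x /=; first by move/eqP->.
by case/andP=> /eqP <- wp; rewrite -vmap_org eqxx -vmap_ter IHp.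
Qed.

Lemma reads_nil G (x : vertex G) : reads x [::] x.
Proof. by exists [::] => /=. Qed.

Lemma reads_edge G (e : edge G) : reads (org e) [:: lab e] (ter e).
Proof. by exists [:: e] => //=; rewrite !eqxx. Qed.

Lemma reads_cat G (x y z : vertex G) u v :
  reads x u y -> reads y v z -> reads x (u ++ v) z.
Proof.
move=> [p wp <-] [q wq <-]; exists (p ++ q); last by rewrite map_cat.
exact: walk_cat wp wq.
Qed.

Lemma reads_winv G (x y : vertex G) u : reads x u y -> reads y (winv u) x.
Proof.
move=> [p wp <-]; exists (rev (map (@bar _ _ G) p)); first exact: walk_rev.
by rewrite /winv map_rev -!map_comp; congr rev; apply: eq_map => e /=; apply: lab_bar.
Qed.

Lemma reads_map G H (f : xmorph G H) (x y : vertex G) u :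
  reads x u y -> reads (f x) u (f y).
Proof.
move=> [p wp <-]; exists (map (emap f) p); first exact: walk_map.
by rewrite -map_comp; apply: eq_map => e /=; apply: emap_lab.
Qed.

Lemma reads_cons G (x y : vertex G) l u :
  reads x (l :: u) y <-> exists e, [/\ org e = x, lab e = l & reads (ter e) u y].
Proof.
split=> [[[|e p] //= /andP[/eqP <- wp] [<- <-]]|[e [<- <- eu]]].
  by exists e; split=> //; exists p.
exact: reads_cat (reads_edge e) eu.
Qed.

(** In a folded graph two consecutive inverse letters can only be read along an edge and back, so
    cancelling them keeps the endpoints. *)
Lemma reads_reduce G (x y : vertex G) u :
  folded G -> reads x u y -> reads x (reduce u) y.
Proof.
move=> foldedG; elim: u x => [|l u IHu] x //= /reads_cons[e [<- <- /IHu]].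
case: (reduce u) => [|l' v] /= ev; first by apply/reads_cons; exists e.
case: eqP => [eq_l|_]; last by apply/reads_cons; exists e.
case/reads_cons: ev => e' [org_e' lab_e']; rewrite (foldedG e' (bar e)) ?ter_bar //.
  by rewrite org_bar.
by rewrite lab_bar lab_e'.
Qed.

Lemma generated_reads G (S : seq (freegroup T)) : folded G ->
  (forall g, g \in S -> reads (base G) g (base G)) ->
  forall g, generated S g -> reads (base G) g (base G).
Proof.
move=> foldedG readS g; elim=> {g} [g /readS//||g h _ rg _ rh|g _ rg].
- exact: reads_nil.
- by apply: reads_reduce => //; apply: reads_cat rg rh.
- by apply: reads_reduce => //; apply: reads_winv.
Qed.

(** Since the graph is folded, an edge leaving the base coincides with the loop read there with the
    same label, so no walk from the base ever leaves it. *)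
Lemma rose_vertices G : folded G -> connected G ->
  (forall x, x \in X -> reads (base G) (fgvar x) (base G)) ->
  forall v : vertex G, v = base G.
Proof.
move=> foldedG connG readX v.
have loop (e : edge G) : org e = base G -> ter e = base G.
  have loopX x b : x \in X -> reads (base G) [:: (x, b)] (base G).
    by case: b => Xx; last apply: (reads_winv (u := [:: (x, true)])); apply: readX.
  move=> org_e; case lab_e: (lab e) => [x b].
  have Xx : x \in X by have := lab_in e; rewrite lab_e.
  have /reads_cons[d [org_d lab_d [[|//] /= /eqP ter_d _]]] := loopX x b Xx.
  by rewrite (foldedG e d) ?org_e ?lab_e.
have [p] := connG v; elim: p {1 3}(base G) (erefl (base G)) => [|e p IHp] x def_x /=.
  by rewrite def_x => /eqP.
by case/andP=> /eqP org_e; apply: IHp; rewrite loop // org_e.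
Qed.

Section OneVertex.
Variable G : xgraph X.
Hypotheses (foldedG : folded G) (oneG : forall v : vertex G, v = base G).

Lemma lab_inj : injective (@lab _ _ G).
Proof. by move=> e e'; apply: foldedG; rewrite [LHS]oneG [RHS]oneG. Qed.

Lemma card_one_vertex : #|vertex G| = 1%N.
Proof.
by rewrite -cardsT -(cards1 (base G)); apply: eq_card => v; rewrite !inE [v]oneG eqxx.
Qed.

Lemma card_pos_edges_one_vertex :
  (forall x, x \in X -> reads (base G) (fgvar x) (base G)) ->
  #|pos_edges G| = #|X|.
Proof.
move=> readX; rewrite -(card_in_imset (f := fun e => (@lab _ _ G e).1)).
  apply: eq_card => x; apply/imsetP/idP => [[e _ ->]|Xx]; first exact: lab_in.
  have /reads_cons[e [_ lab_e _]] := readX x Xx.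
  by exists e; rewrite ?inE lab_e.
move=> e e'; rewrite !inE => pos_e pos_e' eq_l; apply: lab_inj.
by move: pos_e pos_e' eq_l; case: (lab e) (lab e') => x b [y b'] /= -> -> ->.
Qed.

Lemma xiso_rose :
  (forall x, x \in X -> reads (base G) (fgvar x) (base G)) -> xiso G (rose X).
Proof.
move=> readX.
pose fe (e : edge G) : edge (rose X) := (exist _ (lab e).1 (lab_in e), (lab e).2).
have fe_bar e : fe (bar e) = bar (fe e).
  by rewrite /fe /=; congr (_, _); [apply: val_inj|]; rewrite /= lab_bar.
have fe_lab e : lab (fe e) = lab e by rewrite /= -surjective_pairing.
exists (@XMorph T X G (rose X) (fun=> tt) fe erefl (fun=> erefl) fe_bar fe_lab).
have loopX x b : x \in X -> reads (base G) [:: (x, b)] (base G).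
  by case: b => Xx; last apply: (reads_winv (u := [:: (x, true)])); apply: readX.
split=> /=.
  by exists (fun=> base G) => [v|[]].
have [h hP] : exists h : edge (rose X) -> edge G, forall e, lab (h e) = lab e.
  apply: (fin_all_exists (P := fun (e : edge (rose X)) d => lab d = lab e)).
  by move=> [[x Xx] b]; have /reads_cons[e [_ lab_e _]] := loopX x b Xx; exists e.
have lab_rose : injective (@lab _ _ (rose X)).
  by move=> [x b] [y c] /= [/val_inj-> ->].
exists h => e; first by apply: lab_inj; rewrite hP.
by apply: lab_rose; rewrite fe_lab hP.
Qed.

End OneVertex.

Lemma connected_surj G H (f : xmorph G H) :
  surjective f -> connected G -> connected H.
Proof.
move=> surj_f connG y; have [x <-] := surj_f y; have [p wp] := connG x.
by exists (map (emap f) p); rewrite -(vmap_base f); apply: walk_map.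
Qed.

Lemma reduced_path_lab G (p : seq (edge G)) :
  freely_reduced (map (@lab _ _ G) p) -> reduced_path p.
Proof.
rewrite /freely_reduced sorted_map; apply: sub_sorted => e e' /=.
by apply: contra => /eqP->; rewrite lab_bar.
Qed.

(** The label of [p] is freely reduced and morphisms preserve labels, so the image of [p] stays
    reduced even where edges get identified. Together with the reverse path it covers every oriented
    edge. *)
Lemma core_of_reduced_loop G H (f : xmorph G H) (p : seq (edge G)) :
  folded H -> surjective f -> surjective (emap f) -> connected G ->
  walk (base G) p (base G) -> freely_reduced (map (@lab _ _ G) p) ->
  (forall e, e \in p \/ bar e \in p) ->
  (forall v : vertex G, exists e, org e = v) -> pointed_core_graph H.
Proof.
move=> foldedH surj_f surj_ef connG wp red_p sur_p no_isolated.
have core_e (e : edge H) : core_edge e.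
  have [d <-] := surj_ef e.
  have core_in q : walk (base G) q (base G) ->
      freely_reduced (map (@lab _ _ G) q) ->
      d \in q -> core_edge (emap f d).
    move=> wq red_q qd; exists (map (emap f) q); split; last exact: map_f.
      by rewrite -(vmap_base f); apply: walk_map.
    apply: reduced_path_lab; rewrite -map_comp.
    by rewrite (eq_map (g := @lab _ _ G)) // => a /=; apply: emap_lab.
  have [/core_in|pd] := sur_p d; first exact.
  apply: (core_in (rev (map (@bar _ _ G) p))); first exact: walk_rev.
    have -> : map (@lab _ _ G) (rev (map (@bar _ _ G) p)) =
        winv (map (@lab _ _ G) p).
      by rewrite /winv map_rev -!map_comp; congr rev; apply: eq_map => e' /=; apply: lab_bar.
    exact: winv_reduced.
  by rewrite mem_rev; apply/mapP; exists (bar d); rewrite ?barK.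
split=> //; first exact: connected_surj surj_f connG.
move=> y; have [x <-] := surj_f y; have [e <-] := no_isolated x.
by right; exists (emap f e) => //; left; rewrite vmap_org.
Qed.

End Reading.

(** * The cycle spelling a word *)

Section Cycle.
Variables (T : finType) (w : seq (letter T)) (w_gt0 : (0 < size w)%N).
Let C := cycle_graph w_gt0.
Let fwd (t : 'I_(size w)) : edge C := (t, true).

Definition cycle_path : seq (edge C) := map fwd (enum 'I_(size w)).

Lemma cycle_path_lab : map (@lab _ _ C) cycle_path = w.
Proof.
rewrite -map_comp -[RHS](map_tnth_enum (in_tuple w)).
exact: eq_map.
Qed.

(** Taking the end vertex modulo the length lets one induction cover the proper prefixes and the
    full turn back to the base. *)
Lemma walk_cycle (t : nat) (y : vertex C) : (t <= size w)%N ->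
  nat_of_ord y = (t %% size w)%N -> walk (base C) (take t cycle_path) y.
Proof.
elim: t y => [|t IHt] y le_t def_y.
  by rewrite take0 /= -val_eqE /= def_y mod0n.
pose i := Ordinal le_t.
have sz : size cycle_path = size w by rewrite size_map size_enum_ord.
rewrite (take_nth (fwd i)) ?sz // -cats1; apply: (@walk_cat _ _ C _ i).
  by apply: IHt; rewrite ?(ltnW le_t) //= modn_small.
rewrite /cycle_path (nth_map i) ?size_enum_ord //=.
rewrite -[X in nth _ _ X]/(nat_of_ord i) nth_ord_enum eqxx /=.
by rewrite -val_eqE /= def_y.
Qed.

Lemma reads_cycle_prefix (t : 'I_(size w)) : reads (base C) (take t w) (t : vertex C).
Proof.
exists (take t cycle_path); last by rewrite map_take cycle_path_lab.
by apply: walk_cycle; rewrite ?modn_small // ltnW.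
Qed.

Lemma walk_cycle_path : walk (base C) cycle_path (base C).
Proof.
have := @walk_cycle (size w) (base C) (leqnn _); rewrite modnn => /(_ erefl).
by rewrite take_oversize // size_map size_enum_ord.
Qed.

Lemma reads_cycle : reads (base C) w (base C).
Proof. by exists cycle_path; [apply: walk_cycle_path | apply: cycle_path_lab]. Qed.

Lemma cycle_connected : connected C.
Proof. by move=> t; have [p] := reads_cycle_prefix t; exists p. Qed.

Lemma mem_cycle_path (e : edge C) : e \in cycle_path \/ bar e \in cycle_path.
Proof.
by case: e => t []; [left|right]; apply: map_f; rewrite mem_enum.
Qed.

Lemma card_cycle_edges : #|pos_edges C| = size w.
Proof.
apply: double_inj; rewrite -card_edges -muln2.
by rewrite card_prod card_ord card_bool.
Qed.

(** The two edges leaving a vertex are labelled by the next letter and by the inverse of the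
    previous one. These differ by free reduction inside the word and by cyclic reduction at the
    base. *)
Lemma cycle_folded : freely_reduced w -> cyclically_reduced w -> folded C.
Proof.
move=> w_red w_cyc.
have l0 : letter T by case: (w) w_gt0.
have next (t : 'I_(size w)) : tnth (in_tuple w) (ordS t) != linv (tnth (in_tuple w) t).
  rewrite !(tnth_nth l0) /=; have [lt_t|] := ltnP t.+1 (size w).
    by rewrite modn_small //; move/(sortedP l0): w_red; apply.
  move=> ge_t; have -> : t.+1 = size w by apply/eqP; rewrite eqn_leq ge_t ltn_ord.
  rewrite modnn; have -> : nth l0 w t = last l0 w.
    by rewrite -nth_last; congr nth; have := ltn_ord t; lia.
  move: w_cyc; case: (w) w_gt0 => //= l w' _.
  by apply: contra => /eqP eq_l; rewrite [X in linv X]eq_l linvK.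
case=> t [] [t' []] //= eq_org.
- by rewrite eq_org.
- by rewrite eq_org => /eqP; rewrite (negPf (next _)).
- by rewrite -eq_org => /esym/eqP; rewrite (negPf (next _)).
- by move/ordS_inj: eq_org => ->.
Qed.

(** A reduced loop reading [w] runs through every geometric edge, so each folded image equals its
    own pointed core, and passing to the core changes nothing along the chain. *)
Lemma cycle_core_image (H : xgraph (occurring w)) (f : xmorph C H) :
  freely_reduced w -> folded H -> surjective f -> surjective (emap f) ->
  pointed_core_graph H.
Proof.
move=> w_red foldedH surj_f surj_ef.
apply: (core_of_reduced_loop foldedH surj_f surj_ef cycle_connected walk_cycle_path).
- by rewrite cycle_path_lab.
- exact: mem_cycle_path.
- by move=> t; exists (fwd t).
Qed.

End Cycle.

(** * Wedges of loops *)

Section Wedge.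
Variable T : finType.
Implicit Types G C : xgraph [set: T].

(** Over the full alphabet, loops with letters outside [X] may be attached to the same graph. *)
Definition widen (X : {set T}) (G : xgraph X) : xgraph [set: T] :=
  @XGraph T setT (vertex G) (edge G) (base G) (@org _ _ G) (@ter _ _ G)
    (@bar _ _ G) (@lab _ _ G) (@barK _ _ G) (@bar_neq _ _ G) (@org_bar _ _ G)
    (@ter_bar _ _ G) (@lab_bar _ _ G) (fun=> in_setT _).

Lemma walk_widen X (G : xgraph X) (x y : vertex G) p :
  @walk _ _ (widen G) x p y = walk x p y.
Proof. by elim: p x => //= e p IHp x; rewrite IHp. Qed.

Lemma reads_widen X (G : xgraph X) (x y : vertex G) u :
  reads x u y -> @reads _ _ (widen G) x u y.
Proof. by case=> p wp <-; exists p; rewrite ?walk_widen. Qed.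

Lemma connected_widen X (G : xgraph X) : connected G -> connected (widen G).
Proof. by move=> connG v; have [p wp] := connG v; exists p; rewrite walk_widen. Qed.

Section AddLoop.
Variables (G : xgraph [set: T]) (u : seq (letter T)).

Let lvertex : finType := (vertex G + 'I_(size u).-1)%type.
Let ledge : finType := (edge G + 'I_(size u) * bool)%type.

(* The [t]-th vertex of the new loop, which starts and ends at the base. *)
Let loop_vertex (t : nat) : lvertex :=
  if t is t'.+1 then if insub t' is Some i then inr i else inl (base G)
  else inl (base G).

Let lorg (e : ledge) : lvertex :=
  match e with
  | inl e => inl (org e)
  | inr (t, b) => loop_vertex (if b then nat_of_ord t else t.+1)
  end.

Let lter (e : ledge) : lvertex :=
  match e with
  | inl e => inl (ter e)
  | inr (t, b) => loop_vertex (if b then t.+1 else nat_of_ord t)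
  end.

Let lbar (e : ledge) : ledge :=
  match e with inl e => inl (bar e) | inr (t, b) => inr (t, ~~ b) end.

Let llab (e : ledge) : letter T :=
  match e with
  | inl e => lab e
  | inr (t, b) =>
      let l := tnth (in_tuple u) t in if b then l else linv l
  end.

Fact add_loop_barK : involutive lbar.
Proof. by case=> [e|[t b]] /=; rewrite ?barK ?negbK. Qed.

Fact add_loop_bar_neq e : lbar e != e.
Proof.
case: e => [e|[t b]] /=.
  by apply: contra (bar_neq e) => /eqP[->].
by apply/eqP => -[]; case: b.
Qed.

Fact add_loop_org_bar e : lorg (lbar e) = lter e.
Proof. by case: e => [e|[t []]] //=; rewrite org_bar. Qed.

Fact add_loop_ter_bar e : lter (lbar e) = lorg e.
Proof. by case: e => [e|[t []]] //=; rewrite ter_bar. Qed.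

Fact add_loop_lab_bar e : llab (lbar e) = linv (llab e).
Proof. by case: e => [e|[t []]] //=; rewrite ?lab_bar ?linvK. Qed.

Definition add_loop : xgraph [set: T] :=
  @XGraph T setT lvertex ledge (inl (base G)) lorg lter lbar llab
    add_loop_barK add_loop_bar_neq add_loop_org_bar add_loop_ter_bar
    add_loop_lab_bar (fun=> in_setT _).

Definition add_loop_incl : xmorph G add_loop :=
  @XMorph T setT G add_loop inl inl erefl (fun=> erefl) (fun=> erefl)
    (fun=> erefl).

Lemma reads_loop_prefix t : (t <= size u)%N ->
  reads (base add_loop) (take t u) (loop_vertex t : vertex add_loop).
Proof.
elim: t => [|t IHt] ltt; first by rewrite take0; apply: reads_nil.
rewrite -{1}[t.+1]/(nat_of_ord (Ordinal ltt)).+1.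
have l0 : letter T by case: (u) ltt => [|l].
rewrite (take_nth l0) // -cats1; apply: reads_cat (IHt (ltnW ltt)) _.
have := @reads_edge _ _ add_loop (inr (Ordinal ltt, true)).
by rewrite /= (tnth_nth l0).
Qed.

Lemma reads_loop : reads (base add_loop) u (base add_loop).
Proof.
have := reads_loop_prefix (leqnn _); rewrite take_size.
suff -> n : n = size u -> loop_vertex n = base add_loop by [].
by case: n => //= n def_n; rewrite insubF // -def_n ltnn.
Qed.

Lemma add_loop_connected : connected G -> connected add_loop.
Proof.
move=> connG [v|i].
  by have [p wp] := connG v; exists (map (emap add_loop_incl) p);
    apply: (walk_map add_loop_incl).
have lt_i : (i.+1 <= size u)%N by have := ltn_ord i; lia.
have [p wp _] := reads_loop_prefix lt_i; exists p; move: wp.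
by rewrite /loop_vertex valK.
Qed.

(** A nonempty loop brings one vertex fewer than geometric edges; the inequality also covers the
    empty word, which brings neither. *)
Lemma add_loop_rank :
  (#|pos_edges add_loop| + #|vertex G| <= #|pos_edges G| + #|vertex add_loop| + 1)%N.
Proof.
have : (#|pos_edges add_loop|.*2 = #|pos_edges G|.*2 + size u * 2)%N.
  by rewrite -!card_edges card_sum card_prod card_ord card_bool.
rewrite card_sum card_ord; lia.
Qed.

End AddLoop.

Lemma wedge_of_loops C (S : seq (freegroup T)) : connected C ->
  exists G (phi : xmorph C G),
  [/\ connected G, injective phi /\ injective (emap phi),
      forall g, g \in S -> reads (base G) g (base G)
    & (#|pos_edges G| + #|vertex C| <= #|pos_edges C| + #|vertex G| + size S)%N].
Proof.
move=> connC; elim: S => [|g S [G [phi [connG [phi_inj phi_einj] readS rank_G]]]].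
  exists C, (xmorph_id C); split=> //; [split; apply: inj_id | by rewrite addn0].
exists (add_loop G g), (xmorph_comp (add_loop_incl G g) phi); split.
- exact: add_loop_connected.
- by split=> [x y []|x y []]; [apply: phi_inj | apply: phi_einj].
- move=> h; rewrite inE => /orP[/eqP->|/readS read_h]; first exact: reads_loop.
  exact: (reads_map (add_loop_incl G g)).
- by rewrite -[size (g :: S)]/(size S).+1; have := add_loop_rank G g; lia.
Qed.

End Wedge.

(** * Elements with letters in a given set *)

Section FreeSubgroup.
Variables (T : finType) (X : {set T}).

Lemma mem_reduce (u : seq (letter T)) : {subset reduce u <= u}.
Proof.
elim: u => //= l u IHu; have IHl : {subset l :: reduce u <= l :: u}.
  by move=> l'; rewrite inE => /predU1P[->|/IHu ul']; rewrite inE ?eqxx ?ul' ?orbT.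
case: (reduce u) IHl => [|l2 v] //= IHl; case: eqP => // _ l' vl'.
by apply: IHl; rewrite !inE vl' !orbT.
Qed.

Lemma free_subgroup_fgelt (u : seq (letter T)) :
  (forall l, l \in u -> l.1 \in X) -> free_subgroup X (fgelt u).
Proof. by move=> uX l /mem_reduce/uX. Qed.

Lemma free_subgroupM g h :
  free_subgroup X g -> free_subgroup X h -> free_subgroup X (g * h).
Proof.
move=> gX hX; apply: free_subgroup_fgelt => l.
by rewrite mem_cat => /orP[/gX|/hX].
Qed.

Lemma free_subgroupV g : free_subgroup X g -> free_subgroup X g^-1.
Proof.
move=> gX; apply: free_subgroup_fgelt => l; rewrite mem_rev => /mapP[l' /gX gl' ->].
exact: gl'.
Qed.

Lemma generated_free_subgroup (S : seq (freegroup T)) g :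
  (forall h, h \in S -> free_subgroup X h) -> generated S g -> free_subgroup X g.
Proof.
move=> SX; elim=> {g} [g /SX//|//|g h _ gX _ hX|g _ gX].
  exact: free_subgroupM.
exact: free_subgroupV.
Qed.

Lemma free_subgroup_generated (S : seq (freegroup T)) g :
  (forall x, x \in X -> generated S (fgvar x)) -> free_subgroup X g -> generated S g.
Proof.
move=> XS gX; rewrite -[g]fgelt_id -wprod_fgvar; apply: generated_wprod_in => l /gX.
exact: XS.
Qed.

Lemma free_subgroup_fgvar x : x \in X -> free_subgroup X (fgvar x).
Proof. by move=> Xx; apply: free_subgroup_fgelt => l; rewrite inE => /eqP->. Qed.

End FreeSubgroup.

Lemma generated_sub (G : groupType) (S S' : seq G) g :
  {subset S <= S'} -> generated S g -> generated S' g.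
Proof.
move=> sSS'; elim=> {g} [g /sSS'|||].
- exact: gen_in.
- exact: gen1.
- by move=> g h _ Sg _ Sh; apply: genM.
- by move=> g _; apply: genV.
Qed.

(** * Pairs of prefixes *)

Section PrefixPairs.
Variables (T : finType) (w : seq (letter T)) (w_gt0 : (0 < size w)%N).
Let C := cycle_graph w_gt0.
Implicit Types ps : seq ('I_(size w) * 'I_(size w)).

Definition prefix_generators ps : seq (freegroup T) :=
  fgelt w :: [seq prefix_elt w pq.1 * (prefix_elt w pq.2)^-1
    | pq : 'I_(size w) * 'I_(size w) <- ps].

(** Equality of the right cosets $Ha_x$ and $Ha_y$, where $H$ is generated by [w] and the chosen
    pairs. *)
Let same_coset ps (x y : vertex C) : Prop :=
  generated (prefix_generators ps)
    (prefix_elt w (x : 'I_(size w)) * (prefix_elt w (y : 'I_(size w)))^-1).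

Lemma mem_occurring l : l \in w -> l.1 \in occurring w.
Proof. by move=> wl; rewrite inE; apply: map_f. Qed.

Lemma occurring_gt0 : (0 < #|occurring w|)%N.
Proof.
by case: (w) w_gt0 => // l w' _; apply/card_gt0P; exists l.1; rewrite inE mem_head.
Qed.

(** The factor [h] is [1] except at the last letter, where [ordS] wraps around to $a_0=1$ and the
    whole of [w] is left over. *)
Lemma prefix_elt_next ps (t : 'I_(size w)) :
  exists2 h, generated (prefix_generators ps) h &
  prefix_elt w t * fgelt [:: tnth (in_tuple w) t] = h * prefix_elt w (ordS t).
Proof.
have l0 : letter T by case: (w) w_gt0.
have -> : prefix_elt w t * fgelt [:: tnth (in_tuple w) t] = fgelt (take t.+1 w).
  by rewrite -fgeltM (tnth_nth l0) cats1 -take_nth.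
have [lt_t|ge_t] := ltnP t.+1 (size w).
  by exists 1; [apply: gen1 | rewrite mul1g /prefix_elt /= modn_small].
exists (fgelt w); first by apply: gen_in; rewrite mem_head.
have eq_t : t.+1 = size w by apply/eqP; rewrite eqn_leq ge_t ltn_ord.
by rewrite /prefix_elt /= eq_t modnn take0 take_size mulg1.
Qed.

(** An edge from $v_x$ to $v_y$ labelled $l$ satisfies $Ha_xl=Ha_y$, so the coset at the origin and
    the label determine the coset at the end. *)
Lemma same_coset_congruence ps : congruence (same_coset ps).
Proof.
have cosetV x y : same_coset ps x y -> same_coset ps y x.
  by move/genV; rewrite invgM invgK.
have cosetT x y z : same_coset ps x y -> same_coset ps y z -> same_coset ps x z.
  by move=> xy /(genM xy); rewrite mulgA mulgKV.
have edgeP (e : edge C) : exists2 h, generated (prefix_generators ps) h &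
    prefix_elt w (org e : 'I_(size w)) * fgelt [:: lab e] =
    h * prefix_elt w (ter e : 'I_(size w)).
  case: e => t []; have [h Hh def_h] := prefix_elt_next ps t.
    by exists h.
  exists h^-1; first exact: genV.
  apply: (mulgI h); rewrite mulKVg mulgA -def_h -mulgA.
  rewrite -[X in _ * (_ * X)]/(fgelt (winv [:: tnth (in_tuple w) t])).
  by rewrite fgeltV mulgV mulg1.
split=> //; first by move=> x; rewrite /same_coset mulgV; apply: gen1.
move=> e e' eq_org eq_lab; have [h Hh def_h] := edgeP e.
have [h' Hh' def_h'] := edgeP e'.
move: (genM (genM (genV Hh) eq_org) Hh').
have -> : prefix_elt w (org e : 'I_(size w)) =
    h * prefix_elt w (ter e : 'I_(size w)) * (fgelt [:: lab e])^-1.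
  by rewrite -def_h mulgK.
have -> : prefix_elt w (org e' : 'I_(size w)) =
    h' * prefix_elt w (ter e' : 'I_(size w)) * (fgelt [:: lab e])^-1.
  by rewrite eq_lab -def_h' mulgK.
by rewrite !invgM invgK !mulgA mulVg mul1g !mulgKV.
Qed.

(** Comparison with the base, where $a_0=1$, puts every prefix in $H$; each letter of [w] follows,
    being $a_t^{-1}ha_{t+1}$ with $h\in H$ and indices modulo the length. *)
Lemma same_coset_generates ps :
  (forall x y, same_coset ps x y) ->
  forall g, free_subgroup (occurring w) g <-> generated (prefix_generators ps) g.
Proof.
move=> all_same g; split; last first.
  have prefixX t : free_subgroup (occurring w) (prefix_elt w t).
    by apply: free_subgroup_fgelt => l /mem_take; apply: mem_occurring.
  apply: generated_free_subgroup => h; rewrite inE => /orP[/eqP->|/mapP[pq _ ->]].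
    by apply: free_subgroup_fgelt => l; apply: mem_occurring.
  by apply: free_subgroupM => //; apply: free_subgroupV.
have prefixH (t : 'I_(size w)) : generated (prefix_generators ps) (prefix_elt w t).
  have := all_same t (base C); rewrite /same_coset.
  have -> : prefix_elt w (base C : 'I_(size w)) = 1 by rewrite /prefix_elt take0.
  by rewrite invg1 mulg1.
have letterH (t : 'I_(size w)) :
    generated (prefix_generators ps) (fgelt [:: tnth (in_tuple w) t]).
  have [h Hh def_h] := prefix_elt_next ps t.
  rewrite -[fgelt _](mulKg (prefix_elt w t)) def_h.
  by apply: genM; [apply: genV | apply: genM].
apply: free_subgroup_generated => x; rewrite inE.
move=> /mapP[l /(tnthP (in_tuple w))[t ->] ->].
have := letterH t; rewrite fgelt1; case: (tnth _ t) => y [] //= /genV.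
by rewrite invgK.
Qed.

Lemma primitive_generating_pairs : freely_reduced w -> primitive (fgelt w) ->
  exists2 ps : seq ('I_(size w) * 'I_(size w)),
    size ps = #|occurring w|.-1 & generating_pairs ps.
Proof.
move=> w_red [B basB Bw]; have [S ltS genS] := finite_free_basis basB Bw.
have connC : connected (widen C) by apply/connected_widen/cycle_connected.
have [G [phi [connG [phi_inj phi_einj] readS rank_G]]] := wedge_of_loops S connC.
have [K [g g_folds]] := folds_to_exists G.
have [surj_g surj_eg] := folds_to_surjective g_folds.
have foldedK := folds_to_folded g_folds.
(* At the base of [K], [w] is read around the image of the cycle and each element of [S] around that
   of its loop, hence so is everything they generate. *)
have readK (h : freegroup T) : reads (base K) h (base K).
  apply: (generated_reads foldedK _ (genS h)) => k.
  rewrite inE -(vmap_base g) => /orP[/eqP->|/readS]; last exact: reads_map.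
  rewrite /= reduce_id // -(vmap_base phi); do 2!apply: reads_map.
  exact: (reads_widen (reads_cycle w_gt0)).
have oneK := rose_vertices foldedK (connected_surj surj_g connG)
  (fun x _ => readK (fgvar x)).
have cardC : #|pos_edges (widen C)| = size w by apply: (card_cycle_edges w_gt0).
have cardVC : #|vertex (widen C)| = size w by apply: card_ord.
have cardK := card_pos_edges_one_vertex foldedK oneK (fun x _ => readK (fgvar x)).
have [|ps [ps_neq size_ps ps_ker]] := folds_to_image_pairs phi g_folds.
  (* The wedge has at most [size S] more edges than vertices, and [K] has [#|T| - 1] more; since
     [size S < #|T|], folding loses no rank. *)
  by rewrite cardK card_one_vertex // cardsT; move: rank_G; lia.
have cardV : #|vimage (xmorph_comp g phi)| = 1%N.
  rewrite -(cards1 (base K)); apply: eq_card => v; rewrite !inE [v]oneK eqxx.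
  by apply/imsetP; exists (base (widen C)); rewrite ?vmap_base.
have cardE : #|eimage (xmorph_comp g phi)| = #|occurring w|.
  rewrite -(card_in_imset (f := fun e => (@lab _ _ K e).1)).
    apply: eq_card => x; rewrite inE.
    apply/imsetP/mapP => [[_ /imsetP[d _ ->] ->]|].
      by rewrite emap_lab; apply/mapP; have := @lab_in _ _ C d; rewrite inE.
    move=> [l /(tnthP (in_tuple w))[t ->] ->].
    pose d : edge (widen C) := (t, true).
    exists (emap (xmorph_comp g phi) (pos_edge d)).
      by apply: imset_f; apply: pos_edgeP.
    by rewrite emap_lab /pos_edge; case: ifP.
  move=> e e' /(subsetP (eimage_pos _)) + /(subsetP (eimage_pos _)).
  rewrite !inE => pos_e pos_e' eq_l; apply: (lab_inj foldedK oneK).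
  by move: pos_e pos_e' eq_l; case: (lab e) (lab e') => x b [y b'] /= -> -> ->.
(* The cycle has as many edges as vertices, and its image has [#|occurring w|] edges and one vertex;
   the difference is the number of pairs. *)
move: size_ps; rewrite cardV cardE.
rewrite [X in (_ + X + _)%N = _]card_imset //.
rewrite [X in (_ = _ + X)%N]card_imset // cardsT cardC cardVC => size_ps.
(* Swapping a pair inverts $a_pa_q^{-1}$, which leaves $H$ unchanged. *)
pose sortp (pq : 'I_(size w) * 'I_(size w)) :=
  if (pq.1 < pq.2)%N then pq else (pq.2, pq.1).
exists (map sortp ps).
  by rewrite size_map -[#|_|](addnK (size w)) -size_ps addnAC addnK addn1.
split.
  rewrite all_map; apply: sub_all ps_neq => -[p q] /=; rewrite /sortp /=.
  by case: (ltngtP p q) => [||/val_inj->] //=; rewrite eqxx.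
apply: same_coset_generates => x y.
have congR := same_coset_congruence (map sortp ps).
have [Rxx Rsym _ _] := congR.
(* [K] has a single vertex, so the kernel of the folding map relates all vertices of the cycle. *)
apply: (ps_ker _ congR) => [[p q] pq_ps|{}x {}y /phi_inj->|];
  last by rewrite [LHS]oneK [RHS]oneK.
  have : same_coset (map sortp ps) (sortp (p, q)).1 (sortp (p, q)).2.
    by apply: gen_in; rewrite inE; apply/orP; right; apply/map_f/map_f.
  by rewrite /sortp /=; case: ifP => //= _; apply: Rsym.
exact: Rxx.
Qed.

Lemma generating_pairs_primitive ps :
  size ps = #|occurring w|.-1 -> generating_pairs ps -> primitive (fgelt w).
Proof.
move=> size_ps [_ gen_ps].
pose S := prefix_generators ps ++ [seq fgvar x | x <- enum (~: occurring w)].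
have [||B basB SB] := @generated_free_basis _ S.
- rewrite size_cat /= !size_map size_ps -cardE -(cardsC (occurring w)).
  by have := occurring_gt0; lia.
- move=> g; apply: (@free_subgroup_generated _ setT) => [x _|l _];
    last exact: in_setT.
  case: (boolP (x \in occurring w)) => [wx|w'x].
    apply: (@generated_sub _ (prefix_generators ps)).
      by move=> h; rewrite mem_cat => ->.
    exact/gen_ps/free_subgroup_fgvar.
  by apply: gen_in; rewrite mem_cat map_f ?orbT // mem_enum inE.
by exists B => //; apply: SB; rewrite mem_head.
Qed.

(** Each pair raises the rank by at most one. If the total gain equals the number of pairs, every
    identification must have merged distinct vertices, as an immediate quotient requires. *)
Lemma quotient_chain_exists ps (G : xgraph (occurring w)) (psi : xmorph C G) :
  freely_reduced w -> folded G -> surjective psi -> surjective (emap psi) ->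
  exists K (kappa : xmorph G K),
  [/\ folded K, surjective kappa /\ surjective (emap kappa),
      forall pq, pq \in ps -> kappa (psi pq.1) = kappa (psi pq.2),
      (#|pos_edges K| + #|vertex G| <= #|pos_edges G| + #|vertex K| + size ps)%N
    & (#|pos_edges K| + #|vertex G| = #|pos_edges G| + #|vertex K| + size ps)%N ->
      quotient_chain psi ps K].
Proof.
move=> w_red; elim: ps G psi => [|[p q] ps IHps] G psi foldedG surj_psi surj_epsi.
  exists G, (xmorph_id G); split=> //=; first by split=> x; exists x.
    by rewrite addn0.
  by move=> _; apply: chain_nil.
have [H [f f_idf]] := identify_and_fold_exists (psi p) (psi q).
have [[surj_f surj_ef] foldedH f_eq rank_H] := identify_and_foldP f_idf.
have surj_fpsi : surjective (xmorph_comp f psi).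
  by move=> z; have [y <-] := surj_f z; have [x <-] := surj_psi y; exists x.
have surj_efpsi : surjective (emap (xmorph_comp f psi)).
  by move=> z; have [y <-] := surj_ef z; have [x <-] := surj_epsi y; exists x.
have [K [kappa [foldedK [surj_k surj_ek] eq_k rank_K chain_K]]] :=
  IHps H (xmorph_comp f psi) foldedH surj_fpsi surj_efpsi.
exists K, (xmorph_comp kappa f); split=> //=.
- split=> z.
    by have [y <-] := surj_k z; have [x <-] := surj_f y; exists x.
  by have [y <-] := surj_ek z; have [x <-] := surj_ef y; exists x.
- by move=> pq; rewrite inE => /orP[/eqP->|/eq_k //]; rewrite /= f_eq.
- case: eqP rank_H rank_K => _ /=;
  by move: (size ps) #|pos_edges K| #|vertex G| #|vertex H|
    #|pos_edges H| #|pos_edges G| #|vertex K|; lia.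
move=> rank_eq; apply: (@chain_cons _ _ _ _ _ _ _ f) => //; last first.
  apply: chain_K; case: eqP rank_H rank_K rank_eq => _ /=;
  by move: (size ps) #|pos_edges K| #|vertex G| #|vertex H|
    #|pos_edges H| #|pos_edges G| #|vertex K|; lia.
have [connH _ coreVH coreEH] := cycle_core_image w_red foldedH surj_fpsi surj_efpsi.
split; first exact: cycle_core_image surj_psi surj_epsi.
  case: eqP rank_H rank_K rank_eq => // _ /=;
  by move: (size ps) #|pos_edges K| #|vertex G| #|vertex H|
    #|pos_edges H| #|pos_edges G| #|vertex K|; lia.
exists H, f, (xmorph_id H); split=> //; split=> // x; split=> // _; by exists x.
Qed.

Lemma generating_pairs_chain ps :
  freely_reduced w -> cyclically_reduced w ->
  size ps = #|occurring w|.-1 -> generating_pairs ps ->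
  exists R : xgraph (occurring w),
    @quotient_chain _ _ 'I_(size w) C id ps R /\ xiso R (rose (occurring w)).
Proof.
move=> w_red w_cyc size_ps [_ gen_ps].
have foldedC := @cycle_folded _ _ w_gt0 w_red w_cyc.
have surj_id : surjective (xmorph_id C) by move=> x; exists x.
have surj_eid : surjective (emap (xmorph_id C)) by move=> x; exists x.
have [K [kappa [foldedK [surj_k surj_ek] eq_k rank_K chain_K]]] :=
  quotient_chain_exists ps w_red foldedC surj_id surj_eid.
have prefixK (t : 'I_(size w)) : reads (base K) (take t w) (kappa (t : vertex C)).
  by rewrite -(vmap_base kappa); apply: reads_map; apply: reads_cycle_prefix.
have readK x : x \in occurring w -> reads (base K) (fgvar x) (base K).
  move=> wx; apply: (@generated_reads _ _ _ (prefix_generators ps)) => //; last first.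
    exact/gen_ps/free_subgroup_fgvar.
  move=> g; rewrite inE => /orP[/eqP->|/mapP[pq ps_pq ->]].
    apply: reads_reduce => //; rewrite -(vmap_base kappa).
    by apply: reads_map; apply: reads_cycle.
  (* The images of $v_p$ and $v_q$ agree, so $a_p$ read out from the base and $a_q$ read backwards
     close up to a loop. *)
  rewrite -fgeltV -fgeltM; apply: reads_reduce => //.
  apply: reads_cat (prefixK pq.1) _; apply: reads_winv.
  by have := eq_k _ ps_pq => /= ->; apply: prefixK.
have connK := connected_surj surj_k (@cycle_connected _ _ w_gt0).
have oneK := rose_vertices foldedK connK readK.
exists K; split; last exact: xiso_rose.
(* The cycle has equally many edges and vertices, the rose [#|occurring w|] edges and one vertex:
   the gain is exactly [size ps], so the bound is attained. *)
apply: chain_K; rewrite (card_pos_edges_one_vertex foldedK oneK readK).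
rewrite (card_one_vertex oneK) (card_cycle_edges w_gt0).
rewrite [#|vertex C|]card_ord size_ps.
by have := occurring_gt0; lia.
Qed.

End PrefixPairs.

Theorem theorem5p3 (r : nat) (w : seq (letter 'I_r))
    (r_ge2 : 2 <= r) (w_gt0 : 0 < size w)
    (w_red : freely_reduced w) (w_cyc : cyclically_reduced w) :
  let s := #|occurring w| in
  (primitive (fgelt w) <->
     exists ps : s.-1.-tuple ('I_(size w) * 'I_(size w)),
       generating_pairs ps) /\
  (primitive (fgelt w) ->
     exists ps : s.-1.-tuple ('I_(size w) * 'I_(size w)),
       generating_pairs ps /\
       exists R : xgraph (occurring w),
         @quotient_chain _ _ 'I_(size w) (cycle_graph w_gt0) id ps R /\
         xiso R (rose (occurring w))).
Proof.
move=> s; have primP : primitive (fgelt w) ->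
    exists ps : s.-1.-tuple ('I_(size w) * 'I_(size w)), generating_pairs ps.
  move=> /(primitive_generating_pairs w_gt0 w_red)[ps /eqP size_ps gen_ps].
  by exists (Tuple size_ps).
split.
  split=> // -[ps]; apply: generating_pairs_primitive => //; exact: size_tuple.
move=> /primP[ps gen_ps]; exists ps; split=> //.
by apply: generating_pairs_chain gen_ps; rewrite ?size_tuple.
Qed.
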